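(* Let $B$ be an $n$-dimensional compact and orientable Riemannian manifold, $M$ an $m$-dimensional semi-Riemannian manifold of index $r=m-n$ with constant (sectional) curvature $c$, and $\pi:(M,g)\to(B,g')$ a semi-Riemannian submersion with totally umbilic fibres. Suppose that each fibre is a compact manifold, $r\ge2$, $n\ge3$, and that for all $p\in M$ $$g\Bigl(\frac{H_p}{r},\frac{H_p}{r}\Bigr)+c\ge0\qquad\text{and}\qquad 3\,g\Bigl(\frac{H_p}{r},\frac{H_p}{r}\Bigr)+nc-\frac1r\,g_p(A,A)\ge0 .$$ Then $g\bigl(\frac Hr,\frac Hr\bigr)+c\equiv0$.
   Context: All manifolds are smooth and connected. A semi-Riemannian submersion $\pi:(M,g)\to(B,g')$ between semi-Riemannian manifolds is a smooth surjective map such that $\pi_*$ is onto at every point, the fibres $\pi^{-1}(b)$ are semi-Riemannian (nondegenerate) submanifolds of $M$, and $\pi_*$ preserves scalar products of vectors normal to fibres. Throughout, fibres are connected and of dimension $r=\dim M-\dim B>0$. Vectors tangent to fibres are vertical, vectors normal to fibres are horizontal; $v,h$ are the orthogonal projections onto vertical and horizontal parts; $\nabla$ is the Levi-Civita connection of $g$. O'Neill's tensors: $A_EF=h\nabla_{hE}(vF)+v\nabla_{hE}(hF)$, $T_EF=h\nabla_{vE}(vF)+v\nabla_{vE}(hF)$. Let $e_1,\dots,e_m$ be a local orthonormal frame, $g(e_a,e_b)=\varepsilon_a\delta_{ab}$, $\varepsilon_a\in\{-1,1\}$, with $e_i$ ($1\le i\le r$) vertical and $e_\alpha$ ($r+1\le\alpha\le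 m$) horizontal. Put $H=\sum_i\varepsilon_iT_{e_i}e_i$ and $g(A,A)=\sum_{\alpha,\beta}\varepsilon_\alpha\varepsilon_\beta g(A_{e_\alpha}e_\beta,A_{e_\alpha}e_\beta)$ (a function on $M$, with value $g_p(A,A)$ at $p$). The fibres are totally umbilic if $T_UV=\frac1r g(U,V)H$ for all vertical $U,V$. Curvature: $R(E,F)G=\nabla_E\nabla_FG-\nabla_F\nabla_EG-\nabla_{[E,F]}G$; constant curvature $c$ means $R(E,F)G=c\,(g(F,G)E-g(E,G)F)$. *)

(* Defs.v *)
From HB Require Import structures.
From mathcomp Require Import all_boot all_order all_algebra.
From mathcomp Require Import all_classical all_reals all_analysis.
From mathcomp Require Import ring.

Set Implicit Arguments.
Unset Strict Implicit.
Unset Printing Implicit Defensive.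

Import Order.TTheory GRing.Theory Num.Theory.
Import numFieldNormedType.Exports.

Local Open Scope classical_set_scope.
Local Open Scope ring_scope.

Section Smooth.
Context {R : realType} {V W : normedModType R}.

Fixpoint iter_derive (vs : seq V) (f : V -> W) : V -> W :=
  if vs is v :: vs' then iter_derive vs' (fun x => 'D_v f x) else f.

(* Infinite differentiability on an open set U of a finite dimensional V:
   directional derivatives of all orders are differentiable at all points
   of U. *)
Definition smooth_on (U : set V) (f : V -> W) : Prop :=
  forall (vs : seq V) (x : V), U x -> differentiable (iter_derive vs f) x.

End Smooth.

(* Tangent vectors read in a chart are row vectors, so that a differential acts
   by right multiplication: 'd f x u = u *m 'J f x. *)
Section BilinearForm.
Context {R : realType} {m : nat}.
Implicit Types (G : 'M[R]_m) (u w : 'rV[R]_m).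

Definition ip G u w : R := (u *m G *m w^T) 0 0.

Definition positive_definite G : Prop :=
  forall u, u != 0 -> 0 < ip G u u.

(* Subspaces of 'rV_m are row spaces of matrices W. *)
Definition negative_definite_on G (W : 'M[R]_m) : Prop :=
  forall u, (u <= W)%MS -> u != 0 -> ip G u u < 0.

Definition has_index G (k : nat) : Prop :=
  (exists W : 'M[R]_m, negative_definite_on G W /\ \rank W = k) /\
  (forall W : 'M[R]_m, negative_definite_on G W -> (\rank W <= k)%N).

End BilinearForm.

(* Riemannian geometry of an open set of 'rV_m with a metric G. *)
Section LocalConnection.
Context {R : realType} {m : nat}.
Local Notation field := ('rV[R]_m -> 'rV[R]_m).
Implicit Types (G : 'rV[R]_m -> 'M[R]_m) (E F K : field) (x : 'rV[R]_m).

Definition pderiv (f : 'rV[R]_m -> R) (i : 'I_m) x : R :=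
  'D_(delta_mx 0 i) f x.

Definition christoffel G x (i j : 'I_m) : 'rV[R]_m :=
  \row_k (2^-1 * \sum_l invmx (G x) k l *
    (pderiv (fun y => G y j l) i x + pderiv (fun y => G y i l) j x
     - pderiv (fun y => G y i j) l x)).

(* The Levi-Civita connection; see nabla_torsion_free and nabla_metric. *)
Definition nabla G E F : field := fun x =>
  'D_(E x) F x
  + \sum_i \sum_j (E x 0 i * F x 0 j) *: christoffel G x i j.

Definition lie_bracket E F : field := fun x => 'D_(E x) F x - 'D_(F x) E x.

Definition curvature G E F K : field := fun x =>
  nabla G E (nabla G F K) x - nabla G F (nabla G E K) x
  - nabla G (lie_bracket E F) K x.

End LocalConnection.

Section LeviCivita.
Context {R : realType} {m : nat}.
Local Notation field := ('rV[R]_m -> 'rV[R]_m).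
Implicit Types (G : 'rV[R]_m -> 'M[R]_m) (E F K : field) (x : 'rV[R]_m).

Lemma christoffelC G x i j :
  (\forall y \near x, (G y)^T = G y) -> christoffel G x i j = christoffel G x j i.
Proof.
move=> Gs; apply/rowP => k; rewrite !mxE; congr (_ * _); apply: eq_bigr => l _.
congr (_ * _); rewrite [in RHS]addrAC (_ : pderiv _ l x = pderiv (fun y => G y j i) l x).
  by rewrite addrAC [RHS]addrAC [in RHS]addrAC; ring.
apply: near_eq_derive; near=> y.
by rewrite -[in RHS](near Gs y) ?mxE.
Unshelve. all: by end_near. Qed.

Lemma nabla_torsion_free G E F x : (\forall y \near x, (G y)^T = G y) ->
  nabla G E F x - nabla G F E x = lie_bracket E F x.
Proof.
move=> Gs; rewrite /nabla /lie_bracket [X in _ - (_ + X)]exchange_big /=.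
rewrite [X in _ - (_ + X)](_ : _ =
    \sum_i \sum_j (E x 0 i * F x 0 j) *: christoffel G x i j); last first.
  apply: eq_bigr => i _; apply: eq_bigr => j _.
  by rewrite mulrC christoffelC.
by rewrite opprD addrACA subrr addr0.
Qed.

Lemma derive_pderiv (f : 'rV[R]_m -> R) x v : differentiable f x ->
  'D_v f x = \sum_k v 0 k * pderiv f k x.
Proof.
move=> df; rewrite deriveE // [in LHS](row_sum_delta v) linear_sum /=.
by apply: eq_bigr => k _; rewrite linearZ /= /pderiv deriveE.
Qed.

Lemma differentiable_entry p q (f : 'rV[R]_m -> 'M[R]_(p, q)) x i j :
  differentiable f x -> differentiable (fun y => f y i j : R) x.
Proof.
move=> df.
apply: (@differentiable_comp _ _ _ _ f (fun N : 'M[R]_(p, q) => N i j : R)) => //.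
exact: differentiable_coord.
Qed.

Lemma ipE (A : 'M[R]_m) u w :
  ip A u w = \sum_i \sum_j u 0 i * A i j * w 0 j.
Proof.
rewrite /ip mxE exchange_big; apply: eq_bigr => j _.
by rewrite !mxE mulr_suml.
Qed.

Lemma ip_sym (A : 'M[R]_m) u w : A^T = A -> ip A u w = ip A w u.
Proof.
move=> As; have trE (B : 'M[R]_1) : B 0 0 = B^T 0 0 by rewrite mxE.
by rewrite /ip trE !trmx_mul trmxK As mulmxA.
Qed.

Lemma ip_christoffel G x i j p : (G x)^T = G x -> G x \in unitmx ->
  ip (G x) (christoffel G x i j) (delta_mx 0 p) =
  2^-1 * (pderiv (fun y => G y j p) i x + pderiv (fun y => G y i p) j x
     - pderiv (fun y => G y i j) p x).
Proof.
move=> Gs Gu; rewrite ipE.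
pose D l := pderiv (fun y => G y j l) i x + pderiv (fun y => G y i l) j x
     - pderiv (fun y => G y i j) l x.
transitivity (2^-1 * \sum_l (\sum_k invmx (G x) k l * G x k p) * D l).
  rewrite (eq_bigr (fun k => christoffel G x i j 0 k * G x k p)) => [|k _].
    rewrite mulr_sumr.
    under [RHS]eq_bigr do rewrite mulr_suml mulr_sumr.
    rewrite [RHS]exchange_big /=; apply: eq_bigr => k _.
    rewrite mxE -mulrA mulr_suml mulr_sumr; apply: eq_bigr => l _.
    by rewrite -/(D l); ring.
  rewrite (bigD1 p) //= big1 ?addr0 => [|q qp].
    by rewrite [X in _ * X]mxE !eqxx mulr1.
  by rewrite [X in _ * X]mxE eqxx (negbTE qp) mulr0.
have delta l : \sum_k invmx (G x) k l * G x k p = (l == p)%:R.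
  have <- : (1%:M : 'M[R]_m) p l = (l == p)%:R by rewrite mxE eq_sym.
  rewrite -(mulmxV Gu) mxE; apply: eq_bigr => k _.
  by rewrite mulrC -{1}Gs mxE.
congr (_ * _); under eq_bigr do rewrite delta.
rewrite (bigD1 p) //= big1 ?addr0 => [|l lp]; first by rewrite eqxx mul1r.
by rewrite (negbTE lp) mul0r.
Qed.

Lemma ip_suml (A : 'M[R]_m) (I : Type) (r : seq I) (a : I -> R) (u : I -> 'rV_m) w :
  ip A (\sum_(i <- r) a i *: u i) w = \sum_(i <- r) a i * ip A (u i) w.
Proof.
rewrite /ip !mulmx_suml summxE; apply: eq_bigr => i _.
by rewrite -!scalemxAl mxE.
Qed.

Lemma ip_sumr (A : 'M[R]_m) (I : Type) (r : seq I) (a : I -> R) (u : I -> 'rV_m) w :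
  ip A w (\sum_(i <- r) a i *: u i) = \sum_(i <- r) a i * ip A w (u i).
Proof.
rewrite /ip linear_sum mulmx_sumr summxE; apply: eq_bigr => i _.
by rewrite linearZ -scalemxAr mxE.
Qed.

Lemma ipDl (A : 'M[R]_m) u v w : ip A (u + v) w = ip A u w + ip A v w.
Proof. by rewrite /ip !mulmxDl mxE. Qed.

Lemma derive_ip G E F x v :
  differentiable G x -> differentiable E x -> differentiable F x ->
  'D_v (fun y => ip (G y) (E y) (F y)) x =
  ip (G x) ('D_v E x) (F x) + ip (G x) (E x) ('D_v F x)
  + \sum_i \sum_j \sum_k E x 0 i * F x 0 j * (v 0 k * pderiv (fun y => G y i j) k x).
Proof.
move=> dG dE dF.
have dvE i : is_derive x v (fun y => E y 0 i : R) (('D_v E x) 0 i).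
  rewrite derive_mx ?mxE; last exact: diff_derivable.
  exact/derivableP/diff_derivable/differentiable_entry.
have dvF i : is_derive x v (fun y => F y 0 i : R) (('D_v F x) 0 i).
  rewrite derive_mx ?mxE; last exact: diff_derivable.
  exact/derivableP/diff_derivable/differentiable_entry.
have dvG i j : is_derive x v (fun y => G y i j : R)
    (\sum_k v 0 k * pderiv (fun y => G y i j) k x).
  rewrite -derive_pderiv; last exact: differentiable_entry.
  exact/derivableP/diff_derivable/differentiable_entry.
rewrite (_ : (fun y => _) = \sum_i \sum_j
   ((fun y => E y 0 i) * (fun y => G y i j : R) * (fun y => F y 0 j))); last first.
  apply/funext => y; rewrite ipE fct_sumE; apply: eq_bigr => i _.
  by rewrite fct_sumE.
rewrite derive_val !ipE -!big_split /=; apply: eq_bigr => i _.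
rewrite -!big_split /=; apply: eq_bigr => j _.
rewrite -mulr_sumr.
transitivity (E x 0 i * G x i j * ('D_v F x) 0 j + F x 0 j *
  (E x 0 i * (\sum_k v 0 k * pderiv (fun y => G y i j) k x)
   + G x i j * ('D_v E x) 0 i)); first by [].
by ring.
Qed.

Lemma nabla_metric G K E F x :
  (\forall y \near x, (G y)^T = G y) -> G x \in unitmx ->
  differentiable G x -> differentiable E x -> differentiable F x ->
  'D_(K x) (fun y => ip (G y) (E y) (F y)) x =
  ip (G x) (nabla G K E x) (F x) + ip (G x) (E x) (nabla G K F x).
Proof.
move=> Gs Gu dG dE dF; rewrite derive_ip //.
have Gsx := nbhs_singleton Gs.
have Gd i j k : pderiv (fun y => G y i j) k x = pderiv (fun y => G y j i) k x.
  by apply: near_eq_derive; near=> y; rewrite -[in RHS](near Gs y) ?mxE.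
rewrite [ip _ (E x) (nabla _ _ _ _)]ip_sym // /nabla !ipDl addrACA.
rewrite [ip _ ('D_(K x) F x) _]ip_sym //; congr (_ + _).
have H (U V : 'rV[R]_m) : ip (G x)
    (\sum_i \sum_j (K x 0 i * U 0 j) *: christoffel G x i j) V =
    \sum_i \sum_j \sum_k U 0 i * V 0 j * K x 0 k * (2^-1 *
      (pderiv (fun y => G y i j) k x + pderiv (fun y => G y k j) i x
     - pderiv (fun y => G y k i) j x)).
  rewrite (eq_bigr (fun i => 1 *: \sum_j (K x 0 i * U 0 j) *: christoffel G x i j)); last by move=> *; rewrite scale1r.
  rewrite ip_suml; transitivity (\sum_k \sum_i \sum_j U 0 i * V 0 j * K x 0 k * (2^-1 *
      (pderiv (fun y => G y i j) k x + pderiv (fun y => G y k j) i x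
     - pderiv (fun y => G y k i) j x))).
    apply: eq_bigr => k _; rewrite mul1r ip_suml; apply: eq_bigr => i _.
    rewrite {1}(row_sum_delta V) ip_sumr mulr_sumr; apply: eq_bigr => j _.
    by rewrite ip_christoffel //; ring.
  rewrite exchange_big; apply: eq_bigr => i _; exact: exchange_big.
rewrite !H [X in _ = _ + X]exchange_big -big_split; apply: eq_bigr => i _ /=.
rewrite -big_split; apply: eq_bigr => j _ /=.
rewrite -big_split; apply: eq_bigr => k _ /=.
rewrite (Gd j i k) (Gd k i j) (Gd k j i); field.
Unshelve. all: by end_near. Qed.
End LeviCivita.

(* phi : 'rV_m -> 'rV_n is a submersion read in charts. *)
Section LocalSubmersion.
Context {R : realType} {m n : nat}.
Variables (G : 'rV[R]_m -> 'M[R]_m) (phi : 'rV[R]_m -> 'rV[R]_n).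
Local Notation field := ('rV[R]_m -> 'rV[R]_m).
Implicit Types (E F : field) (x u : 'rV[R]_m).

Definition vertical x u : Prop := u *m 'J phi x = 0.

Definition horizontal x u : Prop :=
  forall w, vertical x w -> ip (G x) u w = 0.

Definition vertical_space x : 'M[R]_m := kermx ('J phi x).

Definition horizontal_space x : 'M[R]_m :=
  kermx (G x *m (vertical_space x)^T).

Definition vpart E : field := fun x =>
  E x *m proj_mx (vertical_space x) (horizontal_space x).

Definition hpart E : field := fun x =>
  E x *m proj_mx (horizontal_space x) (vertical_space x).

Definition oneillT E F : field := fun x =>
  hpart (nabla G (vpart E) (vpart F)) x
  + vpart (nabla G (vpart E) (hpart F)) x.

Definition oneillA E F : field := fun x =>
  hpart (nabla G (hpart E) (vpart F)) x
  + vpart (nabla G (hpart E) (hpart F)) x.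

(* Orthonormal frame on W; indices a < r are vertical, the others horizontal. *)
Definition adapted_frame (r : nat) (W : set 'rV[R]_m)
    (eps : 'I_m -> R) (e : 'I_m -> field) : Prop :=
  [/\ forall a, eps a = 1 \/ eps a = -1,
      forall a, smooth_on W (e a),
      forall x (a b : 'I_m), W x ->
        ip (G x) (e a x) (e b x) = if a == b then eps a else 0,
      forall x (a : 'I_m), W x -> (a < r)%N -> vertical x (e a x) &
      forall x (a : 'I_m), W x -> (r <= a)%N -> horizontal x (e a x)].

Definition mean_curvature (r : nat) (eps : 'I_m -> R) (e : 'I_m -> field) :
    field := fun x =>
  \sum_(i < m | (i < r)%N) eps i *: oneillT (e i) (e i) x.

Definition norm_oneillA (r : nat) (eps : 'I_m -> R) (e : 'I_m -> field) x : R :=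
  \sum_(a < m | (r <= a)%N) \sum_(b < m | (r <= b)%N)
    eps a * eps b
    * ip (G x) (oneillA (e a) (e b) x) (oneillA (e a) (e b) x).

End LocalSubmersion.

Section Manifold.
Context {R : realType}.

Record chart (m : nat) (T : topologicalType) := Chart {
  source : set T;
  target : set 'rV[R]_m;
  coord : T -> 'rV[R]_m;
  point_at : 'rV[R]_m -> T;
  source_open : open source;
  target_open : open target;
  coord_target : forall p, source p -> target (coord p);
  point_at_source : forall x, target x -> source (point_at x);
  coordK : forall p, source p -> point_at (coord p) = p;
  point_atK : forall x, target x -> coord (point_at x) = x;
  coord_continuous : forall p, source p -> {for p, continuous coord};
  point_at_continuous : forall x, target x -> {for x, continuous point_at} }.

Definition overlap m T (c c' : chart m T) : set 'rV[R]_m :=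
  [set x | target c x /\ source c' (point_at c x)].

Definition transition m T (c c' : chart m T) : 'rV[R]_m -> 'rV[R]_m :=
  coord c' \o point_at c.

Definition compatible m T (c c' : chart m T) : Prop :=
  smooth_on (overlap c c') (transition c c') /\
  smooth_on (overlap c' c) (transition c' c).

Record manifold (m : nat) := Manifold {
  carrier :> topologicalType;
  atlas : set (chart m carrier);
  manifold_hausdorff : hausdorff_space carrier;
  manifold_second_countable : @second_countable carrier;
  manifold_connected : connected [set: carrier];
  atlas_cover : forall p : carrier, exists2 c, atlas c & source c p;
  atlas_compatible : forall c c', atlas c -> atlas c' -> compatible c c' }.
Arguments atlas {m} _ _.

Definition orientable m (M : manifold m) : Prop :=
  exists A : set (chart m M),
    [/\ forall p : M, exists2 c, A c & source c p,
        forall c c', A c -> atlas M c' -> compatible c c' &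
        forall c c' x, A c -> A c' -> overlap c c' x ->
          0 < \det ('J (transition c c') x)].

(* gram c x is the matrix of the metric at the point of coordinates x, in the
   coordinate basis of the chart c. *)
Record metric m (M : manifold m) := Metric {
  gram : chart m M -> 'rV[R]_m -> 'M[R]_m;
  gram_smooth : forall c, atlas M c -> smooth_on (target c) (gram c);
  gram_sym : forall c x, atlas M c -> target c x -> (gram c x)^T = gram c x;
  gram_nondegenerate : forall c x, atlas M c -> target c x ->
    gram c x \in unitmx;
  gram_change : forall c c' x, atlas M c -> atlas M c' -> overlap c c' x ->
    gram c x = 'J (transition c c') x *m gram c' (transition c c' x)
               *m ('J (transition c c') x)^T;
  gram_index : exists k, forall c x, atlas M c -> target c x ->
    has_index (gram c x) k }.
Arguments gram {m M} _ _ _.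

Definition metric_index m (M : manifold m) (g : metric M) (k : nat) : Prop :=
  forall c x, atlas M c -> target c x -> has_index (gram g c x) k.

Definition riemannian m (M : manifold m) (g : metric M) : Prop :=
  forall c x, atlas M c -> target c x -> positive_definite (gram g c x).

Definition constant_curvature m (M : manifold m) (g : metric M) (k : R) : Prop :=
  forall c (W : set 'rV[R]_m) (E F K : 'rV[R]_m -> 'rV[R]_m) x,
    atlas M c -> open W -> W `<=` target c ->
    smooth_on W E -> smooth_on W F -> smooth_on W K -> W x ->
    curvature (gram g c) E F K x =
      k *: (ip (gram g c x) (F x) (K x) *: E x
            - ip (gram g c x) (E x) (K x) *: F x).

End Manifold.

Arguments chart R m T : clear implicits.
Arguments manifold R m : clear implicits.
Arguments atlas {R m} _ _.

Section Submersion.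
Context {R : realType} {m n : nat} {M : manifold R m} {B : manifold R n}.
Implicit Types (f : M -> B) (c : chart R m M) (d : chart R n B).

Definition local_domain f c d : set 'rV[R]_m :=
  [set x | target c x /\ source d (f (point_at c x))].

Definition local_map f c d : 'rV[R]_m -> 'rV[R]_n :=
  coord d \o f \o point_at c.

Definition smooth_map f : Prop :=
  continuous f /\
  forall c d, atlas M c -> atlas B d ->
    smooth_on (local_domain f c d) (local_map f c d).

Definition fibre f (b : B) : set M := f @^-1` [set b].

(* The tangent spaces of the fibres are the kernels of the differential. *)
Record semi_riemannian_submersion (g : metric M) (g' : metric B) (f : M -> B) :
    Prop := {
  submersion_smooth : smooth_map f;
  submersion_surj : forall b, exists p, f p = b;
  submersion_full : forall c d x, atlas M c -> atlas B d ->
    local_domain f c d x -> row_full ('J (local_map f c d) x);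
  submersion_nondegenerate : forall c d x u, atlas M c -> atlas B d ->
    local_domain f c d x ->
    vertical (local_map f c d) x u ->
    (forall w, vertical (local_map f c d) x w -> ip (gram g c x) u w = 0) ->
    u = 0;
  submersion_isometry : forall c d x u w, atlas M c -> atlas B d ->
    local_domain f c d x ->
    horizontal (gram g c) (local_map f c d) x u ->
    horizontal (gram g c) (local_map f c d) x w ->
    ip (gram g' d (local_map f c d x))
       (u *m 'J (local_map f c d) x) (w *m 'J (local_map f c d) x)
    = ip (gram g c x) u w }.

(* An adapted orthonormal frame on an open set, read in a chart of M whose
   domain meets the preimage of the domain of a chart of B. *)
Record local_frame (g : metric M) (f : M -> B) (r : nat) := LocalFrame {
  fr_chart : chart R m M;
  fr_base : chart R n B;
  fr_dom : set 'rV[R]_m;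
  fr_sign : 'I_m -> R;
  fr_field : 'I_m -> 'rV[R]_m -> 'rV[R]_m;
  fr_chart_atlas : atlas M fr_chart;
  fr_base_atlas : atlas B fr_base;
  fr_open : open fr_dom;
  fr_sub : fr_dom `<=` local_domain f fr_chart fr_base;
  fr_adapted : adapted_frame (gram g fr_chart) (local_map f fr_chart fr_base) r
                 fr_dom fr_sign fr_field }.

Definition frame_around (g : metric M) (f : M -> B) r (p : M)
    (e : local_frame g f r) : Prop :=
  source (fr_chart e) p /\ fr_dom e (coord (fr_chart e) p).

(* H, as a vector field in the chart of the frame e *)
Definition frame_H (g : metric M) (f : M -> B) r (e : local_frame g f r) :
    'rV[R]_m -> 'rV[R]_m :=
  mean_curvature (gram g (fr_chart e)) (local_map f (fr_chart e) (fr_base e))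
    r (fr_sign e) (fr_field e).

(* g (H_p / r, H_p / r) *)
Definition sqnorm_H (g : metric M) (f : M -> B) r (e : local_frame g f r)
    (p : M) : R :=
  let x := coord (fr_chart e) p in
  ip (gram g (fr_chart e) x) (r%:R^-1 *: frame_H e x) (r%:R^-1 *: frame_H e x).

(* g_p (A, A) *)
Definition sqnorm_A (g : metric M) (f : M -> B) r (e : local_frame g f r)
    (p : M) : R :=
  norm_oneillA (gram g (fr_chart e)) (local_map f (fr_chart e) (fr_base e))
    r (fr_sign e) (fr_field e) (coord (fr_chart e) p).

Definition totally_umbilic_fibres (g : metric M) (f : M -> B) (r : nat) : Prop :=
  forall (e : local_frame g f r) (U V : 'rV[R]_m -> 'rV[R]_m),
    let G := gram g (fr_chart e) in
    let phi := local_map f (fr_chart e) (fr_base e) in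
    smooth_on (fr_dom e) U -> smooth_on (fr_dom e) V ->
    (forall x, fr_dom e x -> vertical phi x (U x)) ->
    (forall x, fr_dom e x -> vertical phi x (V x)) ->
    forall x, fr_dom e x ->
      oneillT G phi U V x = (r%:R^-1 * ip (G x) (U x) (V x)) *: frame_H e x.

End Submersion.

(* Main.v *)
Require Import Defs.
From HB Require Import structures.
From mathcomp Require Import all_boot all_order all_algebra.
From mathcomp Require Import all_classical all_reals all_analysis.
From mathcomp Require Import ring lra.

Set Implicit Arguments.
Unset Strict Implicit.
Unset Printing Implicit Defensive.

Import Order.TTheory GRing.Theory Num.Theory.
Import numFieldNormedType.Exports.

Local Open Scope classical_set_scope.
Local Open Scope ring_scope.


(** Let N = H / r and h = g(N, N).  The index hypothesis makes vertical vectors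
    negative definite and the metric of B makes horizontal ones positive
    definite, so h >= 0.  Let V be a vertical field with g(V, V) = -1 and X a
    horizontal field.  Two facts control the second derivatives: the horizontal
    part of nabla_V V is - N, because the fibres are umbilic, and A_X Y is skew in
    the horizontal fields X, Y.  Expanding g(R(X, V) V, X) with them
    ([mixed_curvature]) gives
      X g(N, X) - g(N, nabla_X X) = g(A_X V, A_X V) + g(N, X)^2 + c g(X, X),
    where the first term on the right is non-negative.  For X = N the left side is
    half of the derivative of h along N, hence (1/2) N h >= h (h + c).

    M is compact: B is, and a submersion with compact connected fibres is proper
    ([total_space_compact]).  So h has a maximum; there N h = 0, and the two
    factors of h (h + c) <= 0 are non-negative, so that one of them vanishes.
    If h + c = 0 at the maximum, then h + c <= 0 everywhere and the hypothesis
    h + c >= 0 concludes.  If h = 0 at the maximum, then h = 0 and N = 0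
    everywhere; the identity for a unit horizontal X becomes
    0 = g(A_X V, A_X V) + c, so c <= 0, while c = h + c >= 0.  This is [rigidity].

    The maximum principle needs h as a continuous function on M: adapted frames
    exist around each point ([adapted_frame_exists]), and h does not depend on the
    frame or on the charts ([mean_curvature_invariant]), because the Koszul
    formula writes the second fundamental form with derivatives of functions and
    Lie brackets only.  The naturality of brackets and the skewness of A both rest
    on the symmetry of second derivatives ([schwarz]).  Properness rests on the
    openness of submersions ([submersion_locally_surjective]). *)

(** * Differentiation of vector and matrix valued functions *)

Section Differentiability.
Context {R : realType} {V W : normedModType R}.
Implicit Types (f g : V -> W) (x : V).

Lemma near_eq_diff f g x : (\forall y \near x, f y = g y) ->
  differentiable f x -> differentiable g x.
Proof.
move=> fg /[dup] df /diff_locallyP[dfc dfo].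
have gx : f x = g x := nbhs_singleton fg.
have go : g \o shift x = cst (g x) + 'd f x +o_ (0 : V) id.
  apply/eqaddoP => _/posnumP[e].
  have /eqaddoP /(_ e%:num) /(_ [gt0 of e%:num]) := dfo.
  have : \forall h \near (0 : V), f (h + x) = g (h + x).
    move: fg; rewrite (near_shift 0 x) subr0; exact.
  apply: filter_app2; near=> h => /= fgh.
  change (`|f (h + x) - (f x + 'd f x h)| <= e%:num * `|h| ->
          `|g (h + x) - (g x + 'd f x h)| <= e%:num * `|h|).
  by rewrite -gx -fgh.
have dE : 'd g x = 'd f x :> (V -> W).
  apply/diff_unique; first exact: dfc.
  exact: go.
by apply/diff_locallyP; rewrite dE.
Unshelve. all: by end_near. Qed.

End Differentiability.

Section MatrixValued.
Context {R : realType} {V : normedModType R} {p q : nat}.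
Implicit Types (f : V -> 'M[R]_(p, q)) (x v : V).

Lemma differentiable_mxP f x :
  differentiable f x <-> forall i j, differentiable (fun y => f y i j : R) x.
Proof.
split=> [df i j|df].
  apply: (@differentiable_comp _ _ _ _ f (fun N : 'M[R]_(p, q) => N i j : R)) => //.
  exact: differentiable_coord.
rewrite (_ : f = \sum_(i < p) \sum_(j < q) (fun y => f y i j *: delta_mx i j)).
  apply: differentiable_sum => i; apply: differentiable_sum => j.
  exact: differentiableZl.
apply/funext => y; rewrite {1}[f y]matrix_sum_delta fct_sumE.
by apply: eq_bigr => i _; rewrite fct_sumE.
Qed.

Lemma derive_mxE f x v i j : differentiable f x ->
  ('D_v f x) i j = 'D_v (fun y => f y i j) x.
Proof. by move=> df; rewrite derive_mx ?mxE //; exact: diff_derivable. Qed.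

End MatrixValued.

(** * Smooth functions on an open set *)

Section SmoothOn.
Context {R : realType} {V W : normedModType R} (U : set V).
Hypothesis oU : open U.
Implicit Types (f g : V -> W).

Lemma smooth_on_diff f x : smooth_on U f -> U x -> differentiable f x.
Proof. by move=> sf; exact: (sf [::]). Qed.

Lemma smooth_on_derive f v : smooth_on U f -> smooth_on U (fun x => 'D_v f x).
Proof. by move=> sf vs x; exact: (sf (v :: vs)). Qed.

Lemma near_open x (P : V -> Prop) : U x -> (forall y, U y -> P y) ->
  \forall y \near x, P y.
Proof. by move=> Ux UP; apply: filterS UP _; exact: open_nbhs_nbhs. Qed.

(** Smoothness is the largest class of differentiable functions stable under
    directional derivatives; every closure property below is an instance of
    this principle.  Derivatives are only compared on U, since they are
    meaningless outside. *)
Lemma smooth_on_coind (P : (V -> W) -> Prop) :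
  (forall f, P f -> (forall x, U x -> differentiable f x) /\
     forall v, exists2 g, P g & forall x, U x -> 'D_v f x = g x) ->
  forall f, P f -> smooth_on U f.
Proof.
move=> HP f Pf vs.
suff : forall f g, P g -> (forall x, U x -> f x = g x) ->
  forall x, U x -> differentiable (iter_derive vs f) x by move=> /(_ f f Pf); apply.
elim: vs {f Pf} => [|v vs IH] f g Pg fg x Ux /=.
  have [dg _] := HP _ Pg; apply: near_eq_diff (dg _ Ux).
  by apply: near_open => // y /fg.
have [dg /(_ v)[g' Pg' gg']] := HP _ Pg.
apply: (IH _ g') => // y Uy; rewrite -gg' //.
by apply: near_eq_derive; apply: near_open.
Qed.

Lemma eq_smooth_on f g : (forall x, U x -> f x = g x) ->
  smooth_on U f -> smooth_on U g.
Proof.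
move=> fg sf; apply: (@smooth_on_coind
  (fun g => exists2 f, smooth_on U f & forall x, U x -> f x = g x)); last by exists f.
move=> {}g [{sf fg}f sf fg]; split=> [x Ux|v].
  by apply: near_eq_diff (smooth_on_diff sf Ux); apply: near_open.
exists (fun x => 'D_v f x).
  by exists (fun x => 'D_v f x) => //; exact: smooth_on_derive.
move=> x Ux; apply: near_eq_derive; apply: near_open => // y Uy.
by rewrite fg.
Qed.

Lemma smooth_on_subset (U' : set V) f : U' `<=` U -> smooth_on U f -> smooth_on U' f.
Proof. by move=> sU sf vs x /sU; exact: sf. Qed.

Lemma smooth_on_cst (a : W) : smooth_on U (fun=> a).
Proof.
apply: (@smooth_on_coind (fun f => exists b, f = cst b)); last by exists a.
move=> _ [b ->]; split=> [x _|v]; first exact: differentiable_cst.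
by exists (cst 0) => [|x _]; [exists 0|rewrite derive_cst].
Qed.

End SmoothOn.

Section SmoothScalar.
Context {R : realType} {V : normedModType R} (U : set V).
Hypothesis oU : open U.
Implicit Types (f g : V -> R).

(** The derivative of an expression built from smooth functions is again such an
    expression, which makes this class a witness for [smooth_on_coind]. *)
Inductive smooth_expr : (V -> R) -> Prop :=
| SmoothBase f : smooth_on U f -> smooth_expr f
| SmoothAdd f g : smooth_expr f -> smooth_expr g -> smooth_expr (fun x => f x + g x)
| SmoothMul f g : smooth_expr f -> smooth_expr g -> smooth_expr (fun x => f x * g x)
| SmoothInv f : smooth_expr f -> (forall x, U x -> f x != 0) ->
    smooth_expr (fun x => (f x)^-1)
| SmoothSqrt f : smooth_expr f -> (forall x, U x -> 0 < f x) ->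
    smooth_expr (fun x => Num.sqrt (f x)).

Lemma differentiable_sqrt f x : differentiable f x -> 0 < f x ->
  differentiable (fun y => Num.sqrt (f y)) x.
Proof.
move=> df f0; apply: (@differentiable_comp _ _ _ _ f Num.sqrt) => //.
by apply/derivable1_diffP; have [] := is_derive1_sqrt f0.
Qed.

Lemma derive_comp_sqrt f x v : differentiable f x -> 0 < f x ->
  'D_v (fun y => Num.sqrt (f y)) x = (Num.sqrt (f x) + Num.sqrt (f x))^-1 * 'D_v f x.
Proof.
move=> df f0; have ds : differentiable (Num.sqrt : R -> R) (f x).
  by apply/derivable1_diffP; have [] := is_derive1_sqrt f0.
rewrite deriveE; last exact: differentiable_sqrt.
rewrite (@diff_comp _ _ _ _ f Num.sqrt) //= (deriveE v df).
rewrite diff1E // derive1E derive_sqrt // [LHS]mulrC; congr (_^-1 * _).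
by rewrite mulr_natl mulr2n.
Qed.

Lemma smooth_expr_on f : smooth_expr f -> smooth_on U f.
Proof.
apply: (smooth_on_coind oU) => {}f.
elim=> {f} [f sf|f g sf [df Df] sg [dg Dg]|f g sf [df Df] sg [dg Dg]|
  f sf [df Df] f0|f sf [df Df] f0]; split.
- by move=> x; exact: smooth_on_diff.
- by move=> v; exists (fun x => 'D_v f x) => //; constructor; exact: smooth_on_derive.
- by move=> x Ux; apply: differentiableD; auto.
- move=> v; have [f' sf' ff'] := Df v; have [g' sg' gg'] := Dg v.
  exists (fun x => f' x + g' x); first exact: SmoothAdd.
  move=> x Ux; rewrite -ff' // -gg' //; apply: deriveD; apply: diff_derivable; auto.
- by move=> x Ux; apply: differentiableM; auto.
- move=> v; have [f' sf' ff'] := Df v; have [g' sg' gg'] := Dg v.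
  exists (fun x => f x * g' x + g x * f' x).
    by apply: SmoothAdd; exact: SmoothMul.
  move=> x Ux; rewrite -ff' // -gg' //.
  by apply: deriveM; apply: diff_derivable; auto.
- by move=> x Ux; apply: differentiableV; auto.
- move=> v; have [f' sf' ff'] := Df v.
  exists (fun x => (-1) * (((f x)^-1 * (f x)^-1) * f' x)).
    apply: SmoothMul; first by constructor; exact: smooth_on_cst.
    by apply: SmoothMul => //; apply: SmoothMul; exact: SmoothInv.
  move=> x Ux; rewrite -ff' // deriveV; [|exact: f0|by apply: diff_derivable; auto].
  by rewrite /GRing.scale /= mulN1r mulNr expr2 invfM.
- by move=> x Ux; apply: differentiable_sqrt; auto.
- move=> v; have [f' sf' ff'] := Df v.
  exists (fun x => (Num.sqrt (f x) + Num.sqrt (f x))^-1 * f' x).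
    apply: SmoothMul => //; apply: SmoothInv; first by apply: SmoothAdd; exact: SmoothSqrt.
    by move=> x Ux; rewrite gt_eqF // addr_gt0 // sqrtr_gt0 f0.
  by move=> x Ux; rewrite -ff' // derive_comp_sqrt //; auto.
Qed.

Lemma smooth_onD f g : smooth_on U f -> smooth_on U g ->
  smooth_on U (fun x => f x + g x).
Proof. by move=> sf sg; apply/smooth_expr_on/SmoothAdd; constructor. Qed.

Lemma smooth_onM f g : smooth_on U f -> smooth_on U g ->
  smooth_on U (fun x => f x * g x).
Proof. by move=> sf sg; apply/smooth_expr_on/SmoothMul; constructor. Qed.

Lemma smooth_onV f : smooth_on U f -> (forall x, U x -> f x != 0) ->
  smooth_on U (fun x => (f x)^-1).
Proof. by move=> sf f0; apply/smooth_expr_on/SmoothInv => //; constructor. Qed.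

Lemma smooth_on_sqrt f : smooth_on U f -> (forall x, U x -> 0 < f x) ->
  smooth_on U (fun x => Num.sqrt (f x)).
Proof. by move=> sf f0; apply/smooth_expr_on/SmoothSqrt => //; constructor. Qed.

Lemma smooth_onN f : smooth_on U f -> smooth_on U (fun x => - f x).
Proof.
move=> sf; under [X in smooth_on _ X]eq_fun do rewrite -mulN1r.
by apply: smooth_onM => //; exact: smooth_on_cst.
Qed.

Lemma smooth_onB f g : smooth_on U f -> smooth_on U g ->
  smooth_on U (fun x => f x - g x).
Proof. by move=> sf sg; apply: smooth_onD => //; exact: smooth_onN. Qed.

Lemma smooth_on_sum (I : Type) (s : seq I) (P : pred I) (F : I -> V -> R) :
  (forall i, P i -> smooth_on U (F i)) ->
  smooth_on U (fun x => \sum_(i <- s | P i) F i x).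
Proof.
move=> sF; elim: s => [|i s IH].
  by under [X in smooth_on _ X]eq_fun do rewrite big_nil; exact: smooth_on_cst.
under [X in smooth_on _ X]eq_fun do rewrite big_cons.
by case Pi: (P i) => //; apply: smooth_onD => //; exact: sF.
Qed.

Lemma smooth_on_prod (I : Type) (s : seq I) (P : pred I) (F : I -> V -> R) :
  (forall i, P i -> smooth_on U (F i)) ->
  smooth_on U (fun x => \prod_(i <- s | P i) F i x).
Proof.
move=> sF; elim: s => [|i s IH].
  by under [X in smooth_on _ X]eq_fun do rewrite big_nil; exact: smooth_on_cst.
under [X in smooth_on _ X]eq_fun do rewrite big_cons.
by case Pi: (P i) => //; apply: smooth_onM => //; exact: sF.
Qed.

End SmoothScalar.

Section SmoothMatrix.
Context {R : realType} {V : normedModType R} (U : set V).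
Hypothesis oU : open U.

Lemma smooth_on_mxP p q (f : V -> 'M[R]_(p, q)) :
  smooth_on U f <-> forall i j, smooth_on U (fun x => f x i j : R).
Proof.
split=> [sf i j|sf].
  apply: (@smooth_on_coind _ _ _ U oU
    (fun h => exists2 f : V -> 'M[R]_(p, q), smooth_on U f & h = fun x => f x i j));
    last by exists f.
  move=> _ [{sf}f sf ->]; split=> [x Ux|v].
    by move: i j; apply/differentiable_mxP; exact: smooth_on_diff Ux.
  exists (fun x => ('D_v f x) i j).
    by exists (fun x => 'D_v f x) => //; exact: smooth_on_derive.
  by move=> x Ux; rewrite derive_mxE //; exact: smooth_on_diff Ux.
apply: (@smooth_on_coind _ _ _ U oU
  (fun f : V -> 'M[R]_(p, q) => forall i j, smooth_on U (fun x => f x i j : R))) => //.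
move=> {sf}f sf.
have df x : U x -> differentiable f x.
  by move=> Ux; apply/differentiable_mxP => i j; exact: smooth_on_diff Ux.
split=> // v; exists (fun x => 'D_v f x) => // i j.
apply: eq_smooth_on (smooth_on_derive v (sf i j)) => // x Ux.
by rewrite derive_mxE //; exact: df.
Qed.

Lemma smooth_on_mulmx p q s (A : V -> 'M[R]_(p, q)) (B : V -> 'M[R]_(q, s)) :
  smooth_on U A -> smooth_on U B -> smooth_on U (fun x => A x *m B x).
Proof.
move=> /smooth_on_mxP sA /smooth_on_mxP sB; apply/smooth_on_mxP => i j.
under [X in smooth_on _ X]eq_fun do rewrite mxE.
by apply: smooth_on_sum => // k _; exact: smooth_onM.
Qed.

Lemma smooth_on_addmx p q (A B : V -> 'M[R]_(p, q)) :
  smooth_on U A -> smooth_on U B -> smooth_on U (fun x => A x + B x).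
Proof.
move=> /smooth_on_mxP sA /smooth_on_mxP sB; apply/smooth_on_mxP => i j.
under [X in smooth_on _ X]eq_fun do rewrite mxE.
exact: smooth_onD.
Qed.

Lemma smooth_on_scalemx p q (a : V -> R) (A : V -> 'M[R]_(p, q)) :
  smooth_on U a -> smooth_on U A -> smooth_on U (fun x => a x *: A x).
Proof.
move=> sa /smooth_on_mxP sA; apply/smooth_on_mxP => i j.
under [X in smooth_on _ X]eq_fun do rewrite mxE.
exact: smooth_onM.
Qed.

Lemma smooth_on_summx p q (I : Type) (s : seq I) (P : pred I)
    (F : I -> V -> 'M[R]_(p, q)) :
  (forall i, P i -> smooth_on U (F i)) ->
  smooth_on U (fun x => \sum_(i <- s | P i) F i x).
Proof.
move=> sF; apply/smooth_on_mxP => i j.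
under [X in smooth_on _ X]eq_fun do rewrite summxE.
by apply: smooth_on_sum => // k /sF /smooth_on_mxP.
Qed.

Lemma smooth_on_tr p q (A : V -> 'M[R]_(p, q)) :
  smooth_on U A -> smooth_on U (fun x => (A x)^T).
Proof.
move=> /smooth_on_mxP sA; apply/smooth_on_mxP => i j.
by under [X in smooth_on _ X]eq_fun do rewrite mxE; exact: sA.
Qed.

Lemma smooth_on_det p (A : V -> 'M[R]_p) :
  smooth_on U A -> smooth_on U (fun x => \det (A x)).
Proof.
move=> /smooth_on_mxP sA; rewrite /determinant.
apply: smooth_on_sum => // s _; apply: smooth_onM => //.
  exact: smooth_on_cst.
exact: smooth_on_prod.
Qed.

(** Cramer's rule makes the inverse a quotient of polynomials in the entries. *)
Lemma smooth_on_invmx p (A : V -> 'M[R]_p) : smooth_on U A ->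
  (forall x, U x -> A x \in unitmx) -> smooth_on U (fun x => invmx (A x)).
Proof.
move=> sA uA; apply: (@eq_smooth_on _ _ _ _ oU (fun x => (\det (A x))^-1 *: \adj (A x))).
  by move=> x /uA uAx; rewrite /invmx uAx.
apply: smooth_on_scalemx.
  by apply: smooth_onV => [//||x /uA]; [exact: smooth_on_det|rewrite unitmxE unitfE].
apply/smooth_on_mxP => i j.
under [X in smooth_on _ X]eq_fun do rewrite mxE /cofactor.
apply: smooth_onM => //; first exact: smooth_on_cst.
apply: smooth_on_det; apply/smooth_on_mxP => k l.
under [X in smooth_on _ X]eq_fun do rewrite !mxE.
by move/smooth_on_mxP: sA; apply.
Qed.

End SmoothMatrix.

(** * Symmetry of second derivatives *)

Section Schwarz.
Context {R : realType} {V : normedModType R}.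
Implicit Types (f : V -> R) (x u v : V).

Lemma is_derive_line f x u (s : R) : differentiable f (x + s *: u) ->
  is_derive s 1 (fun s : R => f (x + s *: u)) ('D_u f (x + s *: u)).
Proof.
move=> df; have dg : is_diff s (fun s : R => x + s *: u) (fun s => s *: u).
  by apply: is_diff_eq; rewrite add0r.
have dfg : differentiable (fun s : R => f (x + s *: u)) s.
  by apply: (@differentiable_comp _ _ _ _ (fun s : R => x + s *: u) f).
apply: DeriveDef; first exact: diff_derivable.
rewrite deriveE // (@diff_comp _ _ _ _ (fun s : R => x + s *: u) f) //=.
by rewrite diff_val scale1r deriveE.
Qed.

Lemma mvt_line f x u (t : R) : 0 < t ->
  (forall s : R, 0 <= s <= t -> differentiable f (x + s *: u)) ->
  exists2 s : R, 0 <= s <= t & f (x + t *: u) - f x = t * 'D_u f (x + s *: u).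
Proof.
move=> t0 df; pose g s := f (x + s *: u).
have dg (s : R) : 0 <= s <= t -> is_derive s 1 g ('D_u f (x + s *: u)).
  by move=> /df; exact: is_derive_line.
have [||s s0t E] := @MVT _ g (fun s => 'D_u f (x + s *: u)) 0 t t0.
- by move=> s; rewrite in_itv /= => /andP[s0 st]; apply: dg; rewrite !ltW.
- by apply: derivable_within_continuous => s; rewrite in_itv /= => /dg [].
move: s0t; rewrite in_itv /= => /andP[s0 st].
exists s; first by rewrite !ltW.
by move: E; rewrite /g scale0r addr0 subr0 mulrC.
Qed.

(** The mean value theorem is applied first along u, to the difference of f and
    its translate by t v, and then along v. *)
Lemma mixed_difference f x u v (t : R) : 0 < t ->
  (forall s r : R, 0 <= s <= t -> 0 <= r <= t ->
     differentiable f (x + s *: u + r *: v) /\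
     differentiable (fun y => 'D_u f y) (x + s *: u + r *: v)) ->
  exists s r : R, [/\ 0 <= s <= t, 0 <= r <= t &
    f (x + t *: u + t *: v) - f (x + t *: u) - (f (x + t *: v) - f x) =
    t * (t * 'D_v (fun y => 'D_u f y) (x + s *: u + r *: v))].
Proof.
move=> t0 df; have t00 : 0 <= (0 : R) <= t by rewrite lexx ltW.
have t0t : 0 <= t <= t by rewrite lexx ltW.
pose g y := f (y + t *: v) - f y.
have dgg (s : R) : 0 <= s <= t -> differentiable (fun y => f (y + t *: v)) (x + s *: u).
  move=> st; apply: (@differentiable_comp _ _ _ _ (fun y => y + t *: v) f) => //.
  by have [] := df _ _ st t0t.
have df0 (s : R) : 0 <= s <= t -> differentiable f (x + s *: u).
  by move=> st; have [] := df _ _ st t00; rewrite scale0r addr0.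
have dg (s : R) : 0 <= s <= t -> differentiable g (x + s *: u).
  by move=> st; apply: differentiableB; auto.
have [s st Es] := mvt_line t0 dg.
have shiftE : 'D_u (fun y => f (y + t *: v)) (x + s *: u)
    = 'D_u f (x + s *: u + t *: v).
  rewrite deriveE; last exact: dgg.
  have dfs : differentiable f (x + s *: u + t *: v) by have [] := df _ _ st t0t.
  rewrite (@diff_comp _ _ _ _ (fun y => y + t *: v) f) //= (deriveE u dfs).
  have dsh : is_diff (x + s *: u) (fun y : V => y + t *: v) id.
    by apply: is_diff_eq; rewrite addr0.
  by rewrite diff_val.
have E1 : 'D_u g (x + s *: u) =
    'D_u f (x + s *: u + t *: v) - 'D_u f (x + s *: u).
  rewrite -shiftE; apply: deriveB; apply: diff_derivable; first exact: dgg.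
  exact: df0.
have [r rt Er] : exists2 r : R, 0 <= r <= t & 'D_u f (x + s *: u + t *: v) - 'D_u f (x + s *: u) =
    t * 'D_v (fun y => 'D_u f y) (x + s *: u + r *: v).
  apply: (@mvt_line (fun y => 'D_u f y)) => // r rt.
  by have [] := df _ _ st rt.
exists s, r; split=> //; rewrite -Er -E1 -Es /g.
by congr (_ - _ - _); congr (f _); rewrite addrAC.
Qed.

(** The mixed difference is symmetric in u and v, so that [mixed_difference] gives
    points arbitrarily close to x where the two mixed derivatives take the same
    value; both derivatives are continuous. *)
Lemma schwarz (U : set V) f x u v : open U -> smooth_on U f -> U x ->
  'D_v (fun y => 'D_u f y) x = 'D_u (fun y => 'D_v f y) x.
Proof.
move=> oU sf Ux.
pose fuv y : R := 'D_v (fun y => 'D_u f y) y; pose fvu y : R := 'D_u (fun y => 'D_v f y) y.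
apply/eqP; rewrite -subr_eq0 -normr_le0; apply/ler_addgt0Pl => e e0; rewrite addr0.
have e2 : 0 < e / 2 by rewrite divr_gt0.
have cuv : {for x, continuous fuv}.
  exact/differentiable_continuous/(sf [:: u; v]).
have cvu : {for x, continuous fvu}.
  exact/differentiable_continuous/(sf [:: v; u]).
have : \forall y \near x, [/\ U y, `|fuv x - fuv y| < e / 2 & `|fvu x - fvu y| < e / 2].
  move/cvgrPdist_lt : cuv => /(_ _ e2) cuv; move/cvgrPdist_lt : cvu => /(_ _ e2) cvu.
  have Un : nbhs x U by exact: open_nbhs_nbhs.
  by apply: filterS3 Un cuv cvu => y Uy uvy vuy; split; [exact: Uy|exact: uvy|exact: vuy].
case/nbhs_ballP => d /= d0 Bd.
(* t is so small that the parallelogram spanned by t u and t v at x stays in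
   the ball of radius d. *)
pose t := d / (1 + `|u| + `|v|) / 2.
have N0 : 0 < 1 + `|u| + `|v| by rewrite -addrA ltr_pwDl // addr_ge0.
have t0 : 0 < t by rewrite !divr_gt0.
have inB (s r : R) a b : 0 <= s <= t -> 0 <= r <= t -> `|a| + `|b| = `|u| + `|v| ->
    ball x d (x + s *: a + r *: b).
  move=> /andP[s0 st] /andP[r0 rt] ab.
  rewrite -ball_normE /= opprD addrA opprD addrA subrr add0r -opprD normrN.
  apply: le_lt_trans (ler_normD _ _) _; rewrite !normrZ !ger0_norm //.
  have : s * `|a| + r * `|b| <= t * (`|u| + `|v|).
    by rewrite -ab mulrDr lerD // ler_wpM2r.
  move=> /le_lt_trans; apply.
  have : t * (`|u| + `|v|) <= d / 2.
    rewrite /t mulrAC ler_wpM2r ?invr_ge0 // mulrAC ler_pdivrMr // ler_pM2l //.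
    by rewrite -addrA lerDr.
  by move=> /le_lt_trans; apply; rewrite ltr_pdivrMr // ltr_pMr // ltr1n.
have diffs a b (s r : R) : 0 <= s <= t -> 0 <= r <= t -> `|a| + `|b| = `|u| + `|v| ->
     differentiable f (x + s *: a + r *: b) /\
     differentiable (fun y => 'D_a f y) (x + s *: a + r *: b).
  by move=> st rt ab; have [Uy _ _] := Bd _ (inB _ _ _ _ st rt ab);
    split; [exact: (sf [::])|exact: (sf [:: a])].
have [s [r [st rt E]]] := mixed_difference t0 (fun s r st rt => diffs u v s r st rt erefl).
have [s' [r' [st' rt' E']]] := mixed_difference t0
  (fun s r st rt => diffs v u s r st rt (addrC _ _)).
have EE : fuv (x + s *: u + r *: v) = fvu (x + s' *: v + r' *: u).
  apply: (mulfI (lt0r_neq0 t0)); apply: (mulfI (lt0r_neq0 t0)).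
  apply: (etrans (esym E)); apply: (etrans _ E').
  have swap (a b c d' : R) : a - b - (c - d') = a - c - (b - d') by ring.
  by rewrite (addrAC x (t *: u)) swap.
have [_ H1 _] := Bd _ (inB _ _ _ _ st rt erefl).
have [_ _ H2] := Bd _ (inB _ _ _ _ st' rt' (addrC _ _)).
rewrite -/(fuv x) -/(fvu x) (splitr e).
move: H1 H2; rewrite -{}EE; move: (fuv x) (fvu x) (fuv (x + _ + _)) => a b d' H1 H2.
rewrite (_ : a - b = (a - d') - (b - d')); last by ring.
by apply: le_trans (ler_normB _ _) _; rewrite lerD // ltW.
Qed.

End Schwarz.

(** * Jacobian matrices *)

Section MatrixDerivatives.
Context {R : realType} {V : normedModType R}.

Lemma differentiable_mulmx p q s (A : V -> 'M[R]_(p, q)) (B : V -> 'M[R]_(q, s)) x :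
  differentiable A x -> differentiable B x ->
  differentiable (fun y => A y *m B y) x.
Proof.
move=> /differentiable_mxP dA /differentiable_mxP dB; apply/differentiable_mxP => i j.
rewrite (_ : (fun y => _) = \sum_k (fun y => A y i k * B y k j)).
  by apply: differentiable_sum => k; exact: differentiableM.
by apply/funext => y; rewrite mxE fct_sumE.
Qed.

Lemma derive_mulmx p q s (A : V -> 'M[R]_(p, q)) (B : V -> 'M[R]_(q, s)) x v :
  differentiable A x -> differentiable B x ->
  'D_v (fun y => A y *m B y) x = 'D_v A x *m B x + A x *m 'D_v B x.
Proof.
move=> dA dB; apply/matrixP => i j.
rewrite derive_mxE; last exact: differentiable_mulmx.
have dAe k := (differentiable_mxP A x).1 dA i k.
have dBe k := (differentiable_mxP B x).1 dB k j.
rewrite (_ : (fun y => _) = \sum_k (fun y => A y i k * B y k j)); last first.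
  by apply/funext => y; rewrite mxE fct_sumE.
rewrite derive_sum => [|k]; last first.
  by apply: diff_derivable; exact: differentiableM.
rewrite !mxE -big_split; apply: eq_bigr => k _ /=.
rewrite deriveM; [|exact: diff_derivable..].
rewrite !derive_mxE // addrC; congr (_ + _).
exact: mulrC.
Qed.

Lemma differentiable_tr p q (A : V -> 'M[R]_(p, q)) x :
  differentiable A x -> differentiable (fun y => (A y)^T) x.
Proof.
move=> /differentiable_mxP dA; apply/differentiable_mxP => i j.
by rewrite (_ : (fun y => _) = fun y => A y j i) //; apply/funext => y; rewrite mxE.
Qed.

Lemma derive_tr p q (A : V -> 'M[R]_(p, q)) x u : differentiable A x ->
  'D_u (fun y => (A y)^T) x = ('D_u A x)^T.
Proof.
move=> dA; apply/matrixP => i j; rewrite mxE derive_mxE; last exact: differentiable_tr.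
rewrite derive_mxE //; congr ('D_u _ x).
by apply/funext => y; rewrite mxE.
Qed.

End MatrixDerivatives.

Section Jacobian.
Context {R : realType}.

Lemma mulmx_ext p q (A B : 'M[R]_(p, q)) : (forall u : 'rV_p, u *m A = u *m B) -> A = B.
Proof. by move=> AB; apply/row_matrixP => i; rewrite !rowE. Qed.

Lemma mul_jacobian p q (f : 'rV[R]_p -> 'rV[R]_q) x u :
  differentiable f x -> u *m 'J f x = 'D_u f x.
Proof. by move=> df; rewrite deriveEjacobian. Qed.

Lemma derive_jacobian p q (f : 'rV[R]_p -> 'rV[R]_q) (W : normedModType R)
    (h : 'rV[R]_q -> W) x u :
  differentiable f x -> differentiable h (f x) ->
  'D_u (h \o f) x = 'D_(u *m 'J f x) h (f x).
Proof.
move=> df dh; rewrite mul_jacobian // !deriveE //; last exact: differentiable_comp.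
by rewrite diff_comp.
Qed.

Lemma jacobian_comp p q s (f : 'rV[R]_p -> 'rV[R]_q) (h : 'rV[R]_q -> 'rV[R]_s) x :
  differentiable f x -> differentiable h (f x) ->
  'J (h \o f) x = 'J f x *m 'J h (f x).
Proof.
move=> df dh; apply: mulmx_ext => u.
have dhf : differentiable (h \o f) x by exact: differentiable_comp.
rewrite mulmxA; apply: (etrans (mul_jacobian u dhf)).
apply: (etrans (derive_jacobian u df dh)).
exact: (esym (mul_jacobian _ dh)).
Qed.

Lemma near_eq_jacobian p q (f h : 'rV[R]_p -> 'rV[R]_q) x :
  differentiable f x -> (\forall y \near x, f y = h y) -> 'J f x = 'J h x.
Proof.
move=> df fh; have dh := near_eq_diff fh df.
apply: mulmx_ext => u; apply: (etrans (mul_jacobian u df)).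
by apply: (etrans _ (esym (mul_jacobian u dh))); exact: near_eq_derive.
Qed.

Section Smooth.
Context {p q : nat} (U : set 'rV[R]_p) (f : 'rV[R]_p -> 'rV[R]_q).
Hypotheses (oU : open U) (sf : smooth_on U f).

Lemma smooth_on_jacobian : smooth_on U (fun x => 'J f x).
Proof.
apply/(smooth_on_mxP oU) => i j.
apply: (@eq_smooth_on _ _ _ _ oU (fun x => ('D_(delta_mx 0 i) f x) 0 j)).
  move=> x Ux; rewrite -mul_jacobian; last exact: smooth_on_diff Ux.
  by rewrite -rowE mxE.
move: (smooth_on_derive (delta_mx 0 i) sf).
by move=> /(smooth_on_mxP oU); apply.
Qed.

(** The symmetry of the second differential, with u and v constant vectors. *)
Lemma jacobian_symmetric x u v : U x ->
  u *m 'D_v (fun y => 'J f y) x = v *m 'D_u (fun y => 'J f y) x.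
Proof.
move=> Ux.
have H a b : a *m 'D_b (fun y => 'J f y) x = 'D_b (fun y => 'D_a f y) x.
  rewrite -[LHS]add0r -[X in X + _](mul0mx _ ('J f x)).
  rewrite -[X in X *m _](derive_cst (a : 'rV[R]_p) x b).
  rewrite -(@derive_mulmx _ _ _ _ _ (cst a) (fun y => 'J f y) x b) //; last first.
    by apply: (smooth_on_diff smooth_on_jacobian Ux).
  apply: near_eq_derive; apply: (near_open oU) => // y Uy.
  by rewrite mul_jacobian //; exact: smooth_on_diff Uy.
rewrite !H; apply/rowP => j.
have E a b : ('D_b (fun y => 'D_a f y) x) 0 j = 'D_b (fun y => 'D_a (fun z => f z 0 j) y) x.
  apply: etrans (derive_mxE b 0 j (smooth_on_diff (smooth_on_derive a sf) Ux)) _.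
  apply: near_eq_derive; apply: (near_open oU) => // y Uy.
  exact: derive_mxE (smooth_on_diff sf Uy).
apply: etrans (E u v) _; apply: etrans _ (esym (E v u)).
by apply: (schwarz u v oU _ Ux); move/(smooth_on_mxP oU): sf; apply.
Qed.

End Smooth.
End Jacobian.

(** * Vertical and horizontal vectors at a point *)

Section InnerProduct.
Context {R : realType} {m : nat}.
Implicit Types (G : 'M[R]_m) (u v w : 'rV[R]_m).

Lemma ipDr G u v w : ip G u (v + w) = ip G u v + ip G u w.
Proof. by rewrite /ip linearD mulmxDr mxE. Qed.

Lemma ipZl G a u w : ip G (a *: u) w = a * ip G u w.
Proof. by rewrite /ip -!scalemxAl mxE. Qed.

Lemma ipZr G a u w : ip G u (a *: w) = a * ip G u w.
Proof. by rewrite /ip linearZ -scalemxAr mxE. Qed.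

Lemma ipNl G u w : ip G (- u) w = - ip G u w.
Proof. by rewrite -scaleN1r ipZl mulN1r. Qed.

Lemma ipNr G u w : ip G u (- w) = - ip G u w.
Proof. by rewrite -scaleN1r ipZr mulN1r. Qed.

Lemma ipBl G u v w : ip G (u - v) w = ip G u w - ip G v w.
Proof. by rewrite ipDl ipNl. Qed.

Lemma ipBr G u v w : ip G u (v - w) = ip G u v - ip G u w.
Proof. by rewrite ipDr ipNr. Qed.

Lemma ip0l G w : ip G 0 w = 0.
Proof. by rewrite -[0 in LHS](scale0r 0) ipZl mul0r. Qed.

Lemma ip_eq0 G u : G \in unitmx -> (forall w, ip G u w = 0) -> u = 0.
Proof.
move=> Gu u0; have : u *m G = 0.
  apply/rowP => j; rewrite [RHS]mxE -[RHS](u0 (delta_mx 0 j)) /ip.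
  by rewrite trmx_delta -colE [RHS]mxE.
by move/(congr1 (mulmx^~ (invmx G))); rewrite mulmxK // mul0mx.
Qed.

End InnerProduct.

Section Splitting.
Context {R : realType} {m n : nat} (G : 'M[R]_m) (J : 'M[R]_(m, n)).
Implicit Types u v w : 'rV[R]_m.

(** The pointwise forms of [vertical] and [horizontal]: only the matrices G of the
    metric and J of the differential at the point enter. *)
Definition ver u : Prop := u *m J = 0.
Definition hor u : Prop := forall w, ver w -> ip G u w = 0.

Definition ver_space : 'M[R]_m := kermx J.
Definition hor_space : 'M[R]_m := kermx (G *m ver_space^T).
Definition vproj : 'M[R]_m := proj_mx ver_space hor_space.
Definition hproj : 'M[R]_m := proj_mx hor_space ver_space.

Lemma verP u : ver u <-> (u <= ver_space)%MS.
Proof. by rewrite /ver; split=> /sub_kermxP. Qed.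

Lemma horP u : hor u <-> (u <= hor_space)%MS.
Proof.
split=> [hu|/sub_kermxP hu w /verP/submxP[z ->]].
  apply/sub_kermxP/rowP => j; rewrite mulmxA [RHS]mxE.
  have := hu (row j ver_space) ((verP _).2 (row_sub _ _)).
  by rewrite /ip tr_row colE mulmxA -colE [LHS]mxE.
by rewrite /ip trmx_mul mulmxA -[u *m G *m _]mulmxA hu mul0mx mxE.
Qed.

Lemma verD u w : ver u -> ver w -> ver (u + w).
Proof. by rewrite /ver mulmxDl => -> ->; rewrite addr0. Qed.

Lemma verZ a u : ver u -> ver (a *: u).
Proof. by rewrite /ver -scalemxAl => ->; rewrite scaler0. Qed.

Lemma horD u w : hor u -> hor w -> hor (u + w).
Proof. by move=> hu hw z vz; rewrite ipDl hu // hw // addr0. Qed.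

Lemma horZ a u : hor u -> hor (a *: u).
Proof. by move=> hu z vz; rewrite ipZl hu // mulr0. Qed.

Lemma horN u : hor u -> hor (- u).
Proof. by rewrite -scaleN1r; exact: horZ. Qed.

Hypotheses (Gs : G^T = G) (Gu : G \in unitmx).
Hypothesis nondeg : forall u, ver u -> hor u -> u = 0.

Lemma ver_hor_ip u w : ver u -> hor w -> ip G u w = 0.
Proof. by move=> vu hw; rewrite ip_sym // hw. Qed.

Lemma ver_cap_hor : (ver_space :&: hor_space)%MS = 0.
Proof.
apply/eqP/rowV0P => u; rewrite sub_capmx => /andP[/verP vu /horP hu].
exact: nondeg.
Qed.

Lemma hor_cap_ver : (hor_space :&: ver_space)%MS = 0.
Proof. by rewrite capmxC ver_cap_hor. Qed.

Lemma mxrank_ver_space : \rank ver_space = (m - \rank J)%N.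
Proof. exact: mxrank_ker. Qed.

Lemma mxrank_hor_space : \rank hor_space = \rank J.
Proof.
rewrite mxrank_ker -mxrank_tr trmx_mul trmxK mxrankMfree ?mxrank_ver_space.
  by rewrite subKn // rank_leq_row.
by rewrite Gs row_free_unit.
Qed.

Lemma ver_hor_full u : (u <= ver_space + hor_space)%MS.
Proof.
apply: submx_full; rewrite -[row_full _]/(\rank _ == m).
have := mxrank_sum_cap ver_space hor_space.
rewrite ver_cap_hor mxrank0 addn0 => ->.
by rewrite mxrank_ver_space mxrank_hor_space subnK // rank_leq_row.
Qed.

Lemma vhproj u : u *m vproj + u *m hproj = u.
Proof. by rewrite add_proj_mx // ?ver_cap_hor // ver_hor_full. Qed.

Lemma ver_vproj u : ver (u *m vproj).
Proof. by apply/verP; exact: proj_mx_sub. Qed.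

Lemma hor_hproj u : hor (u *m hproj).
Proof. by apply/horP; exact: proj_mx_sub. Qed.

Lemma vproj_ver u : ver u -> u *m vproj = u.
Proof. by move=> /verP vu; rewrite proj_mx_id ?ver_cap_hor. Qed.

Lemma hproj_hor u : hor u -> u *m hproj = u.
Proof. by move=> /horP hu; rewrite proj_mx_id ?hor_cap_ver. Qed.

Lemma hproj_ver u : ver u -> u *m hproj = 0.
Proof. by move=> /verP vu; rewrite proj_mx_0 ?hor_cap_ver. Qed.

Lemma ip_hprojl u w : hor w -> ip G (u *m hproj) w = ip G u w.
Proof.
move=> hw; rewrite -[in RHS](vhproj u) ipDl [X in X + _]ver_hor_ip ?add0r //.
exact: ver_vproj.
Qed.

Lemma ip_vprojl u w : ver w -> ip G (u *m vproj) w = ip G u w.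
Proof.
by move=> vw; rewrite -[in RHS](vhproj u) ipDl [X in _ + X]hor_hproj // addr0.
Qed.

Section Gradient.
Hypothesis Jfull : row_full J.

Lemma full_tr_inj (a : 'rV[R]_n) : a *m J^T = 0 -> a = 0.
Proof.
move=> aJ; have Jf : row_free J^T by rewrite /row_free mxrank_tr; exact: Jfull.
by apply: (row_free_inj Jf); rewrite aJ mul0mx.
Qed.

Lemma hor_gradient (a : 'rV[R]_n) : hor (a *m J^T *m invmx G).
Proof.
move=> w vw; rewrite /ip mulmxKV // -mulmxA -trmx_mul.
by rewrite [w *m J]vw trmx0 mulmx0 mxE.
Qed.

(** The rows of J^T G^-1 are the gradients of the coordinates of the submersion:
    they are horizontal, and this is their Gram matrix. *)
Lemma gradient_gram_unit : J^T *m invmx G *m J \in unitmx.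
Proof.
rewrite -row_free_unit -kermx_eq0; apply/rowV0P => a /sub_kermxP.
rewrite !mulmxA => a0; apply: full_tr_inj.
have : a *m J^T *m invmx G = 0 by apply: nondeg => //; exact: hor_gradient.
by move/(congr1 (mulmx^~ G)); rewrite mulmxKV // mul0mx.
Qed.

(** [proj_mx] depends on a choice of bases; this formula shows that the horizontal
    projection is a rational function of G and J, hence smooth. *)
Lemma hproj_gradient :
  hproj = J *m invmx (J^T *m invmx G *m J) *m (J^T *m invmx G).
Proof.
apply: mulmx_ext => u; have E : u *m J = (u *m hproj) *m J.
  by rewrite -{1}(vhproj u) mulmxDl (ver_vproj u : _ *m J = 0) add0r.
rewrite -[J *m _ *m _]mulmxA [RHS]mulmxA E.
have Ku := gradient_gram_unit; set K := _ *m J in Ku *.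
move: (u *m hproj) (hor_hproj u) => h hh {E u}.
apply/eqP; rewrite -subr_eq0; apply/eqP; apply: nondeg.
  rewrite /ver mulmxBl -[X in _ - X]mulmxA -[invmx K *m _ *m J]mulmxA -/K.
  by rewrite mulVmx // mulmx1 subrr.
by apply: horD => //; apply: horN; rewrite !mulmxA; exact: hor_gradient.
Qed.

End Gradient.
End Splitting.

Section Definiteness.
Context {R : realType} {m n : nat} (G : 'M[R]_m) (J : 'M[R]_(m, n)).
Hypotheses (Gs : G^T = G) (Gu : G \in unitmx) (Jfull : row_full J).
Hypothesis nondeg : forall u, ver J u -> hor G J u -> u = 0.
Hypothesis hor_pos : forall u, hor G J u -> u != 0 -> 0 < ip G u u.
Hypothesis index : has_index G (m - n).

(** If u were vertical, non-zero and not timelike, then g would be non-negative on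
    the span of u and of the horizontal space.  This span has dimension n + 1, so
    it would meet a negative definite space of dimension m - n. *)
Lemma ver_negative u : ver J u -> u != 0 -> ip G u u < 0.
Proof.
move=> vu u0; rewrite ltNge; apply/negP => uu.
have rJ : \rank J = n by exact/eqP.
have nm : (n <= m)%N by rewrite -rJ rank_leq_row.
have [[W [negW rW]] _] := index.
pose K := (hor_space G J + u)%MS.
have rK : \rank K = n.+1.
  have := mxrank_sum_cap (hor_space G J) u.
  rewrite mxrank_hor_space // rJ rank_rV u0 addn1 -/K => <-.
  rewrite (_ : (_ :&: _)%MS = 0) ?mxrank0 ?addn0 //.
  apply/eqP/rowV0P => w; rewrite sub_capmx => /andP[/horP hw /sub_rVP[a wE]].
  by apply: nondeg => //; rewrite wE; exact: verZ.
have : \rank (K :&: W)%MS != 0%N.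
  have := mxrank_sum_cap K W; rewrite rK rW => E.
  have := rank_leq_col (K + W)%MS; rewrite -lt0n => le_m.
  rewrite -(ltn_add2l (\rank (K + W))) addn0 E.
  by apply: leq_ltn_trans le_m _; rewrite addSn subnKC.
rewrite mxrank_eq0 => /rowV0Pn[w]; rewrite sub_capmx => /andP[wK wW] w0.
have := negW w wW w0.
case/sub_addsmxP: wK => [[a b] /= ->].
have hw : hor G J (a *m hor_space G J) by apply/horP; exact: submxMl.
rewrite (mx11_scalar b) mul_scalar_mx ltNge => /negP; apply.
rewrite ipDl !ipDr ipZr ipZl ipZr (hw _ vu) ipZl (ver_hor_ip Gs vu hw) !mulr0 addr0 add0r.
apply: addr_ge0; last by rewrite mulrA mulr_ge0 // -expr2 sqr_ge0.
have [->|h0] := eqVneq (a *m hor_space G J) 0; first by rewrite ip0l.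
exact/ltW/hor_pos.
Qed.

End Definiteness.

(** * The Levi-Civita connection on smooth fields *)

Section Connection.
Context {R : realType} {m : nat} (W : set 'rV[R]_m) (G : 'rV[R]_m -> 'M[R]_m).
Hypotheses (oW : open W) (sG : smooth_on W G).
Hypotheses (Gs : forall x, W x -> (G x)^T = G x).
Hypotheses (Gu : forall x, W x -> G x \in unitmx).
Local Notation field := ('rV[R]_m -> 'rV[R]_m).
Implicit Types (E F K : field).

Lemma derive_coord (F : field) x u : differentiable F x ->
  'D_u F x = \sum_k u 0 k *: 'D_(delta_mx 0 k) F x.
Proof.
move=> dF; rewrite deriveE // {1}(row_sum_delta u) linear_sum.
by apply: eq_bigr => k _; rewrite linearZ /= deriveE.
Qed.

Lemma smooth_on_ip E F : smooth_on W E -> smooth_on W F ->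
  smooth_on W (fun x => ip (G x) (E x) (F x)).
Proof.
move=> sE sF; rewrite /ip.
have := smooth_on_mulmx oW (smooth_on_mulmx oW sE sG) (smooth_on_tr oW sF).
by move/(smooth_on_mxP oW); apply.
Qed.

Lemma smooth_on_christoffel i j : smooth_on W (fun x => christoffel G x i j).
Proof.
have sp k a b : smooth_on W (fun x => pderiv (fun y => G y a b) k x).
  apply: (@smooth_on_derive _ _ _ W (fun y => G y a b)).
  by move/(smooth_on_mxP oW): sG; apply.
have sGi := smooth_on_invmx oW sG Gu.
apply/(smooth_on_mxP oW) => a k; rewrite /christoffel.
under [X in smooth_on _ X]eq_fun do rewrite mxE.
apply: smooth_onM => //; first exact: smooth_on_cst.
apply: smooth_on_sum => // l _; apply: smooth_onM => //.
  by move/(smooth_on_mxP oW): sGi; apply.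
by apply: smooth_onB => //; apply: smooth_onD.
Qed.

Lemma smooth_on_nabla E F : smooth_on W E -> smooth_on W F ->
  smooth_on W (nabla G E F).
Proof.
move=> sE sF; have /(smooth_on_mxP oW) sEk := sE; have /(smooth_on_mxP oW) sFk := sF.
apply: (@eq_smooth_on _ _ _ _ oW (fun x => \sum_k E x 0 k *: 'D_(delta_mx 0 k) F x +
   \sum_i \sum_j (E x 0 i * F x 0 j) *: christoffel G x i j)).
  by move=> x Wx; rewrite /nabla (derive_coord _ (smooth_on_diff sF Wx)).
apply: smooth_on_addmx => //.
  apply: smooth_on_summx => // k _; apply: smooth_on_scalemx => //.
  exact: smooth_on_derive.
apply: smooth_on_summx => // i _; apply: smooth_on_summx => // j _.
apply: smooth_on_scalemx => //; last exact: smooth_on_christoffel.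
exact: smooth_onM.
Qed.

Lemma nabla_compat K E F x : W x -> smooth_on W E -> smooth_on W F ->
  'D_(K x) (fun y => ip (G y) (E y) (F y)) x =
  ip (G x) (nabla G K E x) (F x) + ip (G x) (E x) (nabla G K F x).
Proof.
move=> Wx sE sF; apply: nabla_metric; last 3 first.
- exact: smooth_on_diff Wx.
- exact: smooth_on_diff Wx.
- exact: smooth_on_diff Wx.
- exact: near_open Gs.
- exact: Gu.
Qed.

Lemma nablaE E F x : nabla G E F x = 'D_(E x) F x +
  \sum_i \sum_j (E x 0 i * F x 0 j) *: christoffel G x i j.
Proof. by []. Qed.

Lemma lie_bracketE E F x : lie_bracket E F x = 'D_(E x) F x - 'D_(F x) E x.
Proof. by []. Qed.

Lemma nabla_torsion E F x : W x ->
  nabla G E F x - nabla G F E x = lie_bracket E F x.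
Proof. by move=> Wx; apply: nabla_torsion_free; exact: near_open Gs. Qed.

Lemma near_eq_nabla E E' F F' x : E x = E' x -> (\forall y \near x, F y = F' y) ->
  nabla G E F x = nabla G E' F' x.
Proof.
move=> EE FF; rewrite /nabla EE (nbhs_singleton FF); congr (_ + _).
exact: near_eq_derive.
Qed.

Lemma nabla_addl E E1 E2 F x : differentiable F x -> E x = E1 x + E2 x ->
  nabla G E F x = nabla G E1 F x + nabla G E2 F x.
Proof.
move=> dF EE; rewrite /nabla !(derive_coord _ dF) EE addrACA -!big_split /=.
apply: eq_bigr => k _; congr (_ + _); first by rewrite mxE scalerDl.
by rewrite -big_split; apply: eq_bigr => j _; rewrite mxE mulrDl scalerDl.
Qed.

(** The right side involves only derivatives of functions and a Lie bracket, which
    behave naturally under changes of coordinates. *)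
Lemma koszul_diag V K x : W x -> differentiable V x -> differentiable K x ->
  ip (G x) (nabla G V V x) (K x) = 'D_(V x) (fun y => ip (G y) (V y) (K y)) x
   - 2^-1 * 'D_(K x) (fun y => ip (G y) (V y) (V y)) x
   + ip (G x) (lie_bracket K V x) (V x).
Proof.
move=> Wx dV dK; have nGs : \forall y \near x, (G y)^T = G y by exact: near_open Gs.
have dG := smooth_on_diff sG Wx.
rewrite !nabla_metric ?Gu // -nabla_torsion // ipBl.
rewrite [ip (G x) (V x) (nabla G K V x)]ip_sym ?Gs //.
rewrite [ip (G x) (V x) (nabla G V K x)]ip_sym ?Gs //.
by field.
Qed.

End Connection.


(** * The curvature identity of a submersion with umbilic fibres *)

Section LocalGeometry.
Context {R : realType} {m n : nat}.
Local Notation field := ('rV[R]_m -> 'rV[R]_m).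

(** A semi-Riemannian submersion read in charts.  Of the metric G' of the base, only
    the values and first derivatives at image points enter. *)
Record submersion_on (W : set 'rV[R]_m) (G : 'rV[R]_m -> 'M[R]_m)
    (phi : 'rV[R]_m -> 'rV[R]_n) (G' : 'rV[R]_n -> 'M[R]_n) : Prop := {
  sub_open : open W;
  sub_metric_smooth : smooth_on W G;
  sub_map_smooth : smooth_on W phi;
  sub_sym : forall x, W x -> (G x)^T = G x;
  sub_unit : forall x, W x -> G x \in unitmx;
  sub_full : forall x, W x -> row_full ('J phi x);
  sub_nondeg : forall x u, W x ->
    ver ('J phi x) u -> hor (G x) ('J phi x) u -> u = 0;
  sub_base_diff : forall x, W x -> differentiable G' (phi x);
  sub_base_sym : forall x, W x -> (G' (phi x))^T = G' (phi x);
  sub_isom : forall x u w, W x ->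
    hor (G x) ('J phi x) u -> hor (G x) ('J phi x) w ->
    ip (G' (phi x)) (u *m 'J phi x) (w *m 'J phi x) = ip (G x) u w }.

Variables (W : set 'rV[R]_m) (G : 'rV[R]_m -> 'M[R]_m).
Variables (phi : 'rV[R]_m -> 'rV[R]_n) (G' : 'rV[R]_n -> 'M[R]_n).
Hypothesis L : submersion_on W G phi G'.
Let oW : open W := sub_open L.
Let sG : smooth_on W G := sub_metric_smooth L.
Let sphi : smooth_on W phi := sub_map_smooth L.
Let Gs := sub_sym L.
Let Gu := sub_unit L.
Let nondeg := sub_nondeg L.
Local Notation verf E := (forall x, W x -> ver ('J phi x) (E x)).
Local Notation horf E := (forall x, W x -> hor (G x) ('J phi x) (E x)).
Local Notation ipG E F := (fun y => ip (G y) (E y) (F y)).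
Local Notation hp x := (hproj (G x) ('J phi x)).
Local Notation vp x := (vproj (G x) ('J phi x)).
Implicit Types (E F K X Y U V : field) (x u w : 'rV[R]_m).

Let sJ : smooth_on W (fun x => 'J phi x) := smooth_on_jacobian oW sphi.

Lemma smooth_on_hproj : smooth_on W (fun x => hp x).
Proof.
have sGi := smooth_on_invmx oW sG Gu.
have sJt := smooth_on_tr oW sJ.
have sJG := smooth_on_mulmx oW sJt sGi.
apply: (@eq_smooth_on _ _ _ _ oW (fun x => 'J phi x *m
   invmx (('J phi x)^T *m invmx (G x) *m 'J phi x) *m (('J phi x)^T *m invmx (G x)))).
  move=> x Wx; rewrite hproj_gradient //; [exact: Gs|exact: Gu|by move=> u; apply: nondeg|].
  exact: sub_full L _ _.
apply: smooth_on_mulmx => //; apply: smooth_on_mulmx => //.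
apply: smooth_on_invmx => //; first exact: smooth_on_mulmx.
by move=> x Wx; apply: gradient_gram_unit; [exact: Gu|by move=> u; apply: nondeg|exact: sub_full L _ _].
Qed.

Lemma smooth_on_hpart E : smooth_on W E -> smooth_on W (fun x => E x *m hp x).
Proof. by move=> sE; apply: smooth_on_mulmx => //; exact: smooth_on_hproj. Qed.

Lemma horf_hpart E : horf (fun x => E x *m hp x).
Proof. by move=> x _; exact: hor_hproj. Qed.

(** The projection of the constant field u extends u. *)
Lemma extend_hor x u : W x -> hor (G x) ('J phi x) u ->
  exists X, [/\ smooth_on W X, horf X & X x = u].
Proof.
move=> Wx hu; exists (fun y => u *m hp y); split.
- by apply: (@smooth_on_hpart (fun=> u)); exact: smooth_on_cst.
- exact: horf_hpart.
- by apply: hproj_hor => // w; exact: nondeg.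
Qed.

Lemma vhprojE x u : W x -> u = u *m vp x + u *m hp x.
Proof. by move=> Wx; rewrite vhproj //; [exact: Gs|exact: Gu|move=> w; exact: nondeg]. Qed.

Lemma extend_ver x u : W x -> ver ('J phi x) u ->
  exists X, [/\ smooth_on W X, verf X & X x = u].
Proof.
move=> Wx vu; exists (fun y => u + (-1) *: (u *m hp y)); split.
- apply: smooth_on_addmx => //; first exact: smooth_on_cst.
  apply: smooth_on_scalemx => //; first exact: smooth_on_cst.
  by apply: (@smooth_on_hpart (fun=> u)); exact: smooth_on_cst.
- move=> y Wy; rewrite scaleN1r {1}(vhprojE u Wy) addrK; exact: ver_vproj.
- by rewrite hproj_ver ?scaler0 ?addr0 // => w; exact: nondeg.
Qed.

Lemma ipC x u w : W x -> ip (G x) u w = ip (G x) w u.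
Proof. by move=> Wx; apply: ip_sym; exact: Gs. Qed.

Lemma ip_hpartl x u w : W x -> hor (G x) ('J phi x) w ->
  ip (G x) (u *m hp x) w = ip (G x) u w.
Proof.
move=> Wx hw; apply: ip_hprojl => //; [exact: Gs|exact: Gu|].
by move=> v; exact: nondeg.
Qed.

Lemma ip_hpartr x u w : W x -> hor (G x) ('J phi x) u ->
  ip (G x) u (w *m hp x) = ip (G x) u w.
Proof. by move=> Wx hu; rewrite ipC // ip_hpartl // ipC. Qed.

Lemma ip_vpartr x u w : W x -> ver ('J phi x) u ->
  ip (G x) u (w *m vp x) = ip (G x) u w.
Proof.
move=> Wx vu; rewrite (ipC u _ Wx) (ipC u _ Wx) ip_vprojl //; [exact: Gs|exact: Gu|].
by move=> v; exact: nondeg.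
Qed.

Lemma nabla_compat_cst K E F (k : R) x : W x -> smooth_on W E -> smooth_on W F ->
  (forall y, W y -> ip (G y) (E y) (F y) = k) ->
  ip (G x) (nabla G K E x) (F x) = - ip (G x) (E x) (nabla G K F x).
Proof.
move=> Wx sE sF EF; apply/eqP; rewrite -addr_eq0 -(nabla_compat oW sG) //.
rewrite (@near_eq_derive _ _ _ _ (fun=> k)) ?derive_cst //.
exact: near_open EF.
Qed.

Lemma horf_verf X U : horf X -> verf U -> forall y, W y -> ip (G y) (X y) (U y) = 0.
Proof. by move=> hX vU y Wy; apply: hX => //; exact: vU. Qed.

Lemma verf_horf X U : horf X -> verf U -> forall y, W y -> ip (G y) (U y) (X y) = 0.
Proof. by move=> hX vU y Wy; rewrite ipC //; exact: horf_verf. Qed.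

Lemma isom_horl x u w : W x -> hor (G x) ('J phi x) u ->
  ip (G' (phi x)) (u *m 'J phi x) (w *m 'J phi x) = ip (G x) u w.
Proof.
move=> Wx hu; have hw : hor (G x) ('J phi x) (w *m hp x) by exact: hor_hproj.
have vw : ver ('J phi x) (w *m vp x) by exact: ver_vproj.
rewrite {1}(vhprojE w Wx) mulmxDl (vw : _ *m _ = 0) add0r (sub_isom L) //.
by rewrite [in RHS](vhprojE w Wx) ipDr (hu _ vw) add0r.
Qed.

(** For a basic field X the right side vanishes, and this is the classical fact that
    [X, U] is vertical. *)
Lemma lie_bracket_hor_ver X U x : W x -> smooth_on W X -> smooth_on W U -> verf U ->
  lie_bracket X U x *m 'J phi x = - 'D_(U x) (fun y => X y *m 'J phi y) x.
Proof.
move=> Wx sX sU vU.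
have dJ := smooth_on_diff sJ Wx; have dX := smooth_on_diff sX Wx.
have dU := smooth_on_diff sU Wx.
have UJ : 'D_(X x) U x *m 'J phi x = - (U x *m 'D_(X x) (fun y => 'J phi y) x).
  apply/eqP; rewrite -addr_eq0 -derive_mulmx //.
  rewrite (@near_eq_derive _ _ _ _ (fun=> 0)) ?derive_cst //.
  exact: near_open vU.
rewrite lie_bracketE mulmxBl UJ derive_mulmx // opprD addrC.
by rewrite (jacobian_symmetric oW sphi _ _ Wx).
Qed.

(** The product of X and Y is that of their images in B, so that only the images are
    differentiated along the fibre ([lie_bracket_hor_ver]): the vertical field U
    preserves the horizontal metric. *)
Lemma oneillA_skew X Y U x : W x -> smooth_on W X -> smooth_on W Y -> smooth_on W U ->
  horf X -> horf Y -> verf U ->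
  ip (G x) (nabla G X Y x) (U x) = - ip (G x) (nabla G Y X x) (U x).
Proof.
move=> Wx sX sY sU hX hY vU.
rewrite (nabla_compat_cst _ Wx sY sU (horf_verf hY vU)).
rewrite (nabla_compat_cst _ Wx sX sU (horf_verf hX vU)).
apply/eqP; rewrite eqr_opp -addr_eq0; apply/eqP.
have XU := nabla_torsion oW Gs X U Wx; have YU := nabla_torsion oW Gs Y U Wx.
have -> : nabla G X U x = nabla G U X x + lie_bracket X U x by rewrite -XU addrC subrK.
have -> : nabla G Y U x = nabla G U Y x + lie_bracket Y U x by rewrite -YU addrC subrK.
rewrite ipDr [X in _ + X]ipDr addrACA.
rewrite -[ip _ (Y x) (lie_bracket _ _ _)]isom_horl //; last exact: hY.
rewrite -[ip _ (X x) (lie_bracket _ _ _)]isom_horl //; last exact: hX.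
rewrite !lie_bracket_hor_ver // !ipNr [ip _ (Y x) _]ipC // -(nabla_compat oW sG) //.
have dXJ : differentiable (fun y => X y *m 'J phi y) x.
  exact: smooth_on_diff (smooth_on_mulmx oW sX sJ) Wx.
have dYJ : differentiable (fun y => Y y *m 'J phi y) x.
  exact: smooth_on_diff (smooth_on_mulmx oW sY sJ) Wx.
have dYt : differentiable (fun y => (Y y *m 'J phi y)^T) x.
  exact: smooth_on_diff (smooth_on_tr oW (smooth_on_mulmx oW sY sJ)) Wx.
have dphi := smooth_on_diff sphi Wx.
have dGp : differentiable (fun y => G' (phi y)) x.
  by apply: (@differentiable_comp _ _ _ _ phi G') => //; exact: sub_base_diff L _ Wx.
have dXG : differentiable (fun y => X y *m 'J phi y *m G' (phi y)) x.
  exact: differentiable_mulmx.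
have DG : 'D_(U x) (fun y => G' (phi y)) x = 0.
  rewrite (derive_jacobian _ dphi (sub_base_diff L Wx)) (vU _ Wx : _ *m _ = 0).
  by rewrite derive0.
rewrite (@near_eq_derive _ _ _ _
   (fun y => (X y *m 'J phi y *m G' (phi y) *m (Y y *m 'J phi y)^T) 0 0)); last first.
  apply: (near_open oW) => // y Wy; rewrite -(sub_isom L Wy) //; [exact: hX|exact: hY].
rewrite -derive_mxE; last exact: differentiable_mulmx.
rewrite derive_mulmx // derive_mulmx // DG mulmx0 addr0 derive_tr // mxE.
rewrite -/(ip (G' (phi x)) _ _) -/(ip (G' (phi x)) _ _).
rewrite [X in X + _ + _]ip_sym; last exact: sub_base_sym L _ Wx.
by rewrite -opprD subrr.
Qed.

Lemma oneillA_diag X x w : W x -> smooth_on W X -> horf X -> ver ('J phi x) w ->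
  ip (G x) (nabla G X X x) w = 0.
Proof.
move=> Wx sX hX /(extend_ver Wx)[U [sU vU <-]].
by apply/eqP; rewrite -eqNr; apply/eqP/esym; exact: oneillA_skew.
Qed.

(** N is the normal curvature vector H / r of the fibres; since N is horizontal,
    the pairing with horizontal vectors determines it. *)
Record umbilic_on N : Prop := {
  umb_smooth : smooth_on W N;
  umb_hor : horf N;
  umbE : forall U U' x w, W x -> smooth_on W U -> smooth_on W U' ->
    verf U -> verf U' -> hor (G x) ('J phi x) w ->
    ip (G x) (nabla G U U' x) w = ip (G x) (U x) (U' x) * ip (G x) (N x) w }.

Section UmbilicFibres.
Variable N : field.
Hypothesis umb : umbilic_on N.
Let sN : smooth_on W N := umb_smooth umb.
Let umbilic := umbE umb.

(** The umbilicity condition is stated for smooth fields; paired with a horizontal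
    field, nabla_U U depends only on the value of U at x, so that differentiable
    fields are enough. *)
Lemma umbilic_diff U x w : W x -> differentiable U x ->
  (\forall y \near x, ver ('J phi y) (U y)) -> hor (G x) ('J phi x) w ->
  ip (G x) (nabla G U U x) w = ip (G x) (U x) (U x) * ip (G x) (N x) w.
Proof.
move=> Wx dU vU hw; have [K [sK hK <-]] := extend_hor Wx hw.
have [V [sV vV Vx]] := extend_ver Wx (nbhs_singleton vU).
have nW : \forall y \near x, W y := near_open oW Wx (fun _ => id).
have UK : \forall y \near x, ip (G y) (U y) (K y) = 0.
  by apply: filterS2 vU nW => y vU Wy; rewrite ipC // hK.
have := nabla_metric U (near_open oW Wx Gs) (Gu Wx) (smooth_on_diff sG Wx) dU
  (smooth_on_diff sK Wx).
rewrite (near_eq_derive _ UK) derive_cst => /esym/eqP; rewrite addr_eq0 => /eqP ->.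
have -> : nabla G U K x = nabla G V K x.
  by apply: near_eq_nabla; [rewrite Vx|apply: filterE].
rewrite -Vx -(nabla_compat_cst _ Wx sV sK (verf_horf hK vV)).
by apply: umbilic => //; exact: hK.
Qed.

Variables (V : field) (eps c : R).
Hypotheses (sV : smooth_on W V) (vV : verf V).
Hypothesis unitV : forall x, W x -> ip (G x) (V x) (V x) = eps.
Hypothesis curv : forall E F K x, smooth_on W E -> smooth_on W F -> smooth_on W K ->
  W x -> curvature G E F K x =
    c *: (ip (G x) (F x) (K x) *: E x - ip (G x) (E x) (K x) *: F x).

Lemma shape_operator X U x w : W x -> smooth_on W X -> smooth_on W U -> horf X -> verf U ->
  ver ('J phi x) w ->
  ip (G x) (nabla G U X x) w = - (ip (G x) (U x) w * ip (G x) (N x) (X x)).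
Proof.
move=> Wx sX sU hX vU /(extend_ver Wx)[U' [sU' vU' <-]].
rewrite (nabla_compat_cst _ Wx sX sU' (horf_verf hX vU')).
by rewrite [X in - X]ipC // umbilic //; exact: hX.
Qed.

Lemma nabla_unit K x : W x -> ip (G x) (nabla G K V x) (V x) = 0.
Proof.
move=> Wx; have := nabla_compat_cst K Wx sV sV unitV.
by rewrite [X in - X]ipC // => /esym/eqP; rewrite eqNr => /eqP.
Qed.

(** The horizontal part of nabla_X V is A_X V, so that this is the adjunction between
    A on vertical and on horizontal vectors, combined with the skewness of A. *)
Lemma oneillA_adjoint X x w : W x -> smooth_on W X -> horf X -> hor (G x) ('J phi x) w ->
  ip (G x) (nabla G (fun=> w) V x) (X x) = - ip (G x) w (nabla G X V x *m hp x).
Proof.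
move=> Wx sX hX hw; have [Y [sY hY Yx]] := extend_hor Wx hw.
have -> : nabla G (fun=> w) V x = nabla G Y V x.
  by apply: near_eq_nabla; [rewrite Yx|apply: filterE].
rewrite (nabla_compat_cst _ Wx sV sX (verf_horf hX vV)) [X in - X]ipC //.
rewrite (oneillA_skew Wx sY sX sV hY hX vV) opprK.
rewrite (nabla_compat_cst _ Wx sY sV (horf_verf hY vV)) Yx.
by rewrite ip_hpartr.
Qed.

(** The three terms T1, T2, T3 of g(R(X, V) V, X) are computed by moving a derivative
    from one factor to the other; the products that appear are known functions:
    g(nabla_V V, X) = eps g(N, X), and g(nabla_X V, X) = 0 by skewness of A. *)
Lemma mixed_curvature X x : W x -> smooth_on W X -> horf X ->
  eps * ('D_(X x) (ipG N X) x - ip (G x) (N x) (nabla G X X x))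
  + ip (G x) (nabla G X V x *m hp x) (nabla G X V x *m hp x)
  = eps * (ip (G x) (N x) (X x) ^+ 2 + c * ip (G x) (X x) (X x)).
Proof.
move=> Wx sX hX.
set a := nabla G X V x *m hp x; set nx := ip (G x) (N x) (X x).
pose S := nabla G V V; pose Y := nabla G X V.
have sS : smooth_on W S by exact: smooth_on_nabla.
have sY : smooth_on W Y by exact: smooth_on_nabla.
have ha : hor (G x) ('J phi x) a by exact: hor_hproj.
have := curv sX sV sV Wx; rewrite /curvature.
move=> /(congr1 (fun u => ip (G x) u (X x))).
rewrite ipZl !ipBl !ipZl unitV // (horf_verf hX vV) // mul0r subr0.
have hXX : hor (G x) ('J phi x) (nabla G X X x) by move=> w; exact: oneillA_diag.
have T1 : ip (G x) (nabla G X S x) (X x) =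
    eps * ('D_(X x) (ipG N X) x - ip (G x) (N x) (nabla G X X x)).
  have := nabla_compat oW sG Gs Gu X Wx sS sX.
  have := umbilic Wx sV sV vV vV hXX; rewrite unitV // => ->.
  rewrite (@near_eq_derive _ _ _ _ (fun y => eps *: ip (G y) (N y) (X y))); last first.
    by apply: (near_open oW) => // y Wy; have := umbilic Wy sV sV vV vV (hX _ Wy); rewrite unitV // => ->.
  rewrite deriveZ; last exact/diff_derivable/(smooth_on_diff (smooth_on_ip oW sG sN sX)).
  by rewrite mulrBr => E; apply/eqP; rewrite eq_sym subr_eq; apply/eqP.
have T2 : ip (G x) (nabla G V Y x) (X x) = - ip (G x) a (nabla G V X x).
  have YX y : W y -> ip (G y) (Y y) (X y) = 0.
    move=> Wy; rewrite (nabla_compat_cst _ Wy sV sX (verf_horf hX vV)) ipC //.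
    by rewrite oneillA_diag ?oppr0 //; exact: vV.
  rewrite (nabla_compat_cst _ Wx sY sX YX); congr (- _).
  rewrite {1}(vhprojE (Y x) Wx) ipDl [X in X + _]ipC // shape_operator //; last first.
    exact: ver_vproj.
  by rewrite ip_vpartr ?[ip _ (V x) _]ipC ?nabla_unit ?mul0r ?oppr0 ?add0r //; exact: vV.
have LE : lie_bracket X V x = Y x - nabla G V X x by rewrite -(nabla_torsion oW Gs).
(* nabla is tensorial in its direction, and the two parts of the bracket are
   handled by adjunction and by umbilicity respectively. *)
pose lh := lie_bracket X V x *m hp x; pose lv := lie_bracket X V x *m vp x.
have vlv : ver ('J phi x) lv by exact: ver_vproj.
have hlh : hor (G x) ('J phi x) lh by exact: hor_hproj.
have [Z [sZ vZ Zx]] := extend_ver Wx vlv.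
have T3 : ip (G x) (nabla G (lie_bracket X V) V x) (X x) =
    - (ip (G x) a a - ip (G x) a (nabla G V X x)) + eps * nx ^+ 2.
  rewrite (@nabla_addl _ _ _ _ (fun=> lh) Z _ _ (smooth_on_diff sV Wx)); last first.
    by rewrite Zx addrC -vhprojE.
  rewrite ipDl oneillA_adjoint // umbilic //; last exact: hX.
  congr (- _ + _); first by rewrite ip_hpartl // LE ipBl -[ip _ (Y x) a]ip_hpartl // [X in _ - X]ipC.
  rewrite Zx ipC // ip_vpartr // ?LE ?ipBr; last exact: vV.
  rewrite [X in X - _]ipC // nabla_unit // [X in _ - X]ipC // shape_operator //; last exact: vV.
  by rewrite unitV // sub0r opprK -/nx mulrAC -mulrA expr2.
rewrite {}T1 {}T2 {}T3 => E.
rewrite [in RHS]mulrDr [in RHS](mulrCA eps c) -E.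
by move: ('D_(X x) _ x - _) (ip _ a a) (ip _ a (nabla _ _ _ _)) => d p q; ring.
Qed.

End UmbilicFibres.
End LocalGeometry.

(** * Independence of the mean curvature from charts and frames *)

Lemma near_comp (S T : topologicalType) (f : S -> T) (s : S) (t : T) (P : T -> Prop) :
  f @ s --> t -> (\forall y \near t, P y) -> \forall z \near s, P (f z).
Proof. by move=> fst Pt; apply: fst. Qed.

Section CoordinateChange.
Context {R : realType} {m : nat}.
Local Notation field := ('rV[R]_m -> 'rV[R]_m).
Variables (W W' O : set 'rV[R]_m) (G Gp : 'rV[R]_m -> 'M[R]_m).
Variables (tau sigma : 'rV[R]_m -> 'rV[R]_m) (x : 'rV[R]_m).
Hypotheses (oW : open W) (sG : smooth_on W G).
Hypothesis Gs : forall y, W y -> (G y)^T = G y.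
Hypothesis Gu : forall y, W y -> G y \in unitmx.
Hypotheses (oW' : open W') (sGp : smooth_on W' Gp).
Hypothesis Gps : forall y, W' y -> (Gp y)^T = Gp y.
Hypothesis Gpu : forall y, W' y -> Gp y \in unitmx.
Hypotheses (oO : open O) (stau : smooth_on O tau).
Hypotheses (Wx : W x) (W'x : W' (tau x)) (Ox : O x).
Hypothesis dsigma : differentiable sigma (tau x).
Hypothesis sigmaK : \forall y \near x, sigma (tau y) = y.
Hypothesis GE : \forall y \near x,
  G y = 'J tau y *m Gp (tau y) *m ('J tau y)^T.
Implicit Types (V K : field) (u w : 'rV[R]_m).

(** The pushforward of V by a change of coordinates tau with inverse sigma. *)
Definition push_field V : field := fun z => V (sigma z) *m 'J tau (sigma z).

Let J := 'J tau x.
Let sJ : smooth_on O (fun y => 'J tau y) := smooth_on_jacobian oO stau.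
Let dtau : differentiable tau x := smooth_on_diff stau Ox.
Let sx : sigma (tau x) = x := nbhs_singleton sigmaK.

Lemma push_field_at V : push_field V (tau x) = V x *m J.
Proof. by rewrite /push_field sx. Qed.

Lemma push_field_tau V : \forall y \near x, push_field V (tau y) = V y *m 'J tau y.
Proof. by apply: filterS sigmaK => y yE; rewrite /push_field yE. Qed.

Lemma ip_push u w : ip (Gp (tau x)) (u *m J) (w *m J) = ip (G x) u w.
Proof. by rewrite /ip (nbhs_singleton GE) trmx_mul !mulmxA. Qed.

Lemma differentiable_push V : differentiable V x -> differentiable (push_field V) (tau x).
Proof.
move=> dV; have dJ := smooth_on_diff sJ Ox.
apply: (@differentiable_comp _ _ _ _ sigma (fun y => V y *m 'J tau y)) => //.
by rewrite sx; apply: differentiable_mulmx.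
Qed.

Lemma derive_push (U : normedModType R) (h : 'rV[R]_m -> U) u :
  differentiable h (tau x) -> 'D_(u *m J) h (tau x) = 'D_u (h \o tau) x.
Proof. by move=> dh; rewrite derive_jacobian. Qed.

Lemma derive_push_field V u : differentiable V x ->
  'D_(u *m J) (push_field V) (tau x) =
  'D_u V x *m J + V x *m 'D_u (fun y => 'J tau y) x.
Proof.
move=> dV; rewrite derive_push; last exact: differentiable_push.
rewrite (near_eq_derive _ (push_field_tau V)) derive_mulmx //.
exact: smooth_on_diff sJ Ox.
Qed.

(** The second derivatives of tau cancel by symmetry. *)
Lemma lie_bracket_push K V : differentiable K x -> differentiable V x ->
  lie_bracket (push_field K) (push_field V) (tau x) = lie_bracket K V x *m J.
Proof.
move=> dK dV; rewrite !lie_bracketE !push_field_at !derive_push_field //.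
rewrite (jacobian_symmetric oO stau (V x) (K x) Ox) mulmxBl.
by rewrite opprD addrACA subrr addr0.
Qed.

Lemma derive_ip_push K V u : differentiable K x -> differentiable V x ->
  'D_(u *m J) (fun z => ip (Gp z) (push_field V z) (push_field K z)) (tau x) =
  'D_u (fun y => ip (G y) (V y) (K y)) x.
Proof.
move=> dK dV; rewrite derive_push.
  apply: near_eq_derive; near=> y => /=.
  rewrite (near (push_field_tau V)) // (near (push_field_tau K)) //.
  by rewrite /ip [in RHS](near GE) // trmx_mul !mulmxA.
have dV' := differentiable_push dV; have dK' := differentiable_push dK.
have dG := smooth_on_diff sGp W'x.
have dKt := differentiable_tr dK'.
have := differentiable_mulmx (differentiable_mulmx dV' dG) dKt.
by move/differentiable_mxP; apply.
Unshelve. all: by end_near. Qed.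

(** The connection is natural because each term of [koszul_diag] is. *)
Lemma nabla_push V w : differentiable V x ->
  ip (Gp (tau x)) (nabla Gp (push_field V) (push_field V) (tau x)) (w *m J) =
  ip (G x) (nabla G V V x) w.
Proof.
move=> dV; pose K : field := fun=> w.
have dK : differentiable K x by exact: differentiable_cst.
rewrite -(push_field_at K) (koszul_diag oW' sGp Gps Gpu W'x); last first.
- exact: differentiable_push.
- exact: differentiable_push.
rewrite (koszul_diag oW sG Gs Gu Wx dV dK) lie_bracket_push //.
by rewrite !push_field_at !derive_ip_push // ip_push.
Qed.

End CoordinateChange.

Section MeanCurvatureInvariance.
Context {R : realType} {m n : nat}.
Variables (W W' O : set 'rV[R]_m) (G Gp : 'rV[R]_m -> 'M[R]_m).
Variables (phi phi' : 'rV[R]_m -> 'rV[R]_n) (B B' : 'rV[R]_n -> 'M[R]_n).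
Variables (tau sigma : 'rV[R]_m -> 'rV[R]_m) (x : 'rV[R]_m).
Variables (N N' V : 'rV[R]_m -> 'rV[R]_m) (eps : R).
Hypotheses (L : submersion_on W G phi B) (L' : submersion_on W' Gp phi' B').
Hypotheses (uN : umbilic_on W G phi N) (uN' : umbilic_on W' Gp phi' N').
Hypotheses (oO : open O) (stau : smooth_on O tau).
Hypotheses (Wx : W x) (W'x : W' (tau x)) (Ox : O x).
Hypothesis dsigma : differentiable sigma (tau x).
Hypothesis sigmaK : \forall y \near x, sigma (tau y) = y.
Hypothesis tauK : \forall z \near tau x, tau (sigma z) = z.
Hypothesis GE : \forall y \near x,
  G y = 'J tau y *m Gp (tau y) *m ('J tau y)^T.
Hypothesis verE : \forall y \near x, forall w,
  ver ('J phi y) w <-> ver ('J phi' (tau y)) (w *m 'J tau y).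
Hypotheses (sV : smooth_on W V) (vV : forall y, W y -> ver ('J phi y) (V y)).
Hypotheses (unitV : ip (G x) (V x) (V x) = eps) (eps0 : eps != 0).

(** The image of the vertical field V is again vertical, and in both charts the
    horizontal part of its covariant derivative along itself is eps times the
    normal curvature vector at the point. *)
Lemma mean_curvature_invariant :
  ip (Gp (tau x)) (N' (tau x)) (N' (tau x)) = ip (G x) (N x) (N x).
Proof.
have [oW sG _ Gs Gu _ ndeg _ _ _] := L; have [oW' sGp _ Gps Gpu _ ndeg' _ _ _] := L'.
have GxE := nbhs_singleton GE; have verxE := nbhs_singleton verE.
set J := 'J tau x in GxE verxE.
have Ju : J \in unitmx.
  by move: (Gu _ Wx); rewrite GxE !unitmx_mul => /andP[/andP[]].
have sx : sigma (tau x) = x := nbhs_singleton sigmaK.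
have ipJ u w : ip (Gp (tau x)) (u *m J) (w *m J) = ip (G x) u w by exact: ip_push.
have horJ w : hor (Gp (tau x)) ('J phi' (tau x)) (w *m J) <-> hor (G x) ('J phi x) w.
  split=> hw z vz; first by rewrite -ipJ; apply: hw; exact: (verxE z).1.
  rewrite -(mulmxKV Ju z) ipJ; apply: hw; apply: (verxE _).2.
  by rewrite mulmxKV.
suff -> : N' (tau x) = N x *m J by rewrite ipJ.
have dV := smooth_on_diff sV Wx.
have dV' : differentiable (push_field tau sigma V) (tau x).
  exact: (differentiable_push oO stau Ox dsigma sigmaK dV).
have vV' : \forall z \near tau x, ver ('J phi' z) (push_field tau sigma V z).
  have cs : sigma @ tau x --> x.
    by rewrite -{2}sx; exact: differentiable_continuous.
  have Ws : \forall z \near tau x, W (sigma z) by apply: cs; exact: open_nbhs_nbhs.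
  pose P y := forall w, ver ('J phi y) w <-> ver ('J phi' (tau y)) (w *m 'J tau y).
  have vs : \forall z \near tau x, P (sigma z).
    have vP : \forall y \near x, P y.
      exact: verE.
    exact: near_comp cs vP.
  near=> z; have zE : tau (sigma z) = z by near: z.
  rewrite /push_field -{1}zE; apply: ((near vs z _ _).1 _) => //; apply: vV.
  exact: (near Ws z).
have key w : hor (Gp (tau x)) ('J phi' (tau x)) w ->
    ip (Gp (tau x)) (N' (tau x) - N x *m J) w = 0.
  move=> hw; have [k wE] : exists k, k *m J = w.
    by exists (w *m invmx J); exact: mulmxKV.
  have hk : hor (G x) ('J phi x) k by apply: (horJ k).1; rewrite wE.
  have E1 := umbilic_diff L' uN' W'x dV' vV' hw.
  have E2 := nabla_push oW sG Gs Gu oW' sGp Gps Gpu oO stau Wx W'x Ox dsigma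
    sigmaK GE k dV.
  rewrite -/J wE E1 (umbE uN Wx sV sV vV vV hk) unitV in E2.
  move: E2; rewrite (push_field_at sigmaK) ipJ unitV // => /(mulfI eps0).
  by move=> E; rewrite ipBl E -wE ipJ subrr.
have hD : hor (Gp (tau x)) ('J phi' (tau x)) (N' (tau x) - N x *m J).
  apply: horD; first exact: umb_hor uN' _ W'x.
  by apply: horN; apply: (horJ _).2; exact: umb_hor uN _ Wx.
apply/eqP; rewrite -subr_eq0; apply/eqP; apply: (ip_eq0 (Gpu _ W'x)) => w.
by rewrite (vhprojE L' w W'x) ipDr hD ?key ?addr0 //; [exact: hor_hproj|exact: ver_vproj].
Unshelve. all: by end_near. Qed.

End MeanCurvatureInvariance.

(** * Existence of adapted frames *)

Section AdaptedFrame.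
Context {R : realType} {m n : nat}.
Local Notation field := ('rV[R]_m -> 'rV[R]_m).
Variables (W : set 'rV[R]_m) (G : 'rV[R]_m -> 'M[R]_m).
Variables (phi : 'rV[R]_m -> 'rV[R]_n) (B : 'rV[R]_n -> 'M[R]_n).
Hypothesis L : submersion_on W G phi B.
Hypothesis hor_pos : forall x u, W x -> hor (G x) ('J phi x) u -> u != 0 ->
  0 < ip (G x) u u.
Hypothesis ver_neg : forall x u, W x -> ver ('J phi x) u -> u != 0 ->
  ip (G x) u u < 0.
Variable x0 : 'rV[R]_m.
Hypothesis Wx0 : W x0.
Let r := (m - n)%N.
Let oW : open W := sub_open L.

Definition frame_sign (a : nat) : R := if (a < r)%N then -1 else 1.

Lemma frame_sign_sq a : frame_sign a * frame_sign a = 1.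
Proof. by rewrite /frame_sign; case: ifP => _; rewrite ?mulrNN mulr1. Qed.

(** Treating both kinds of frame vectors at once, the frame is built by a single
    induction on the number of its members. *)
Definition of_kind (a : nat) x u : Prop :=
  if (a < r)%N then ver ('J phi x) u else hor (G x) ('J phi x) u.

Lemma of_kindD a x u w : of_kind a x u -> of_kind a x w -> of_kind a x (u + w).
Proof. by rewrite /of_kind; case: ifP => _; [exact: verD|exact: horD]. Qed.

Lemma of_kindZ a x k u : of_kind a x u -> of_kind a x (k *: u).
Proof. by rewrite /of_kind; case: ifP => _; [exact: verZ|exact: horZ]. Qed.

Lemma of_kind0 a x : of_kind a x 0.
Proof.
rewrite /of_kind; case: ifP => _; first by rewrite /ver mul0mx.
by move=> w _; rewrite ip0l.
Qed.

Lemma of_kind_sum a x (I : Type) (s : seq I) (P : pred I) (F : I -> 'rV[R]_m) :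
  (forall i, P i -> of_kind a x (F i)) -> of_kind a x (\sum_(i <- s | P i) F i).
Proof.
move=> HF; elim/big_rec: _ => [|i u Pi ku]; first exact: of_kind0.
by apply: of_kindD => //; exact: HF.
Qed.

Lemma of_kind_sign a x u : W x -> of_kind a x u -> u != 0 ->
  0 < frame_sign a * ip (G x) u u.
Proof.
move=> Wx; rewrite /of_kind /frame_sign; case: ifP => _ ku u0.
  by rewrite mulN1r oppr_gt0 ver_neg.
by rewrite mul1r hor_pos.
Qed.

Lemma of_kind_ortho a b x u w : W x -> (a < r)%N -> (r <= b)%N ->
  of_kind a x u -> of_kind b x w -> ip (G x) w u = 0.
Proof. by move=> Wx ar br; rewrite /of_kind ar ltnNge br /= => vu hw; exact: hw. Qed.

Lemma extend_kind a x u : W x -> of_kind a x u ->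
  exists X, [/\ smooth_on W X, forall y, W y -> of_kind a y (X y) & X x = u].
Proof.
move=> Wx; rewrite /of_kind; case: (a < r)%N => ku.
  by have [X [sX vX Xx]] := extend_ver L Wx ku; exists X; split.
by have [X [sX hX Xx]] := extend_hor L Wx ku; exists X; split.
Qed.

Record partial_frame k (U : set 'rV[R]_m) (e : nat -> field) : Prop := PartialFrame {
  pf_open : open U;
  pf_mem : U x0;
  pf_sub : U `<=` W;
  pf_smooth : forall a, (a < k)%N -> smooth_on U (e a);
  pf_kind : forall a x, (a < k)%N -> U x -> of_kind a x (e a x);
  pf_ortho : forall a b x, (a < k)%N -> (b < k)%N -> U x ->
        ip (G x) (e a x) (e b x) = if a == b then frame_sign a else 0 }.

Lemma kernel_vector p (S : 'M[R]_m) (C : 'M[R]_(m, p)) : (p < \rank S)%N ->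
  exists u : 'rV[R]_m, [/\ (u <= S)%MS, u *m C = 0 & u != 0].
Proof.
move=> pS; have : (S :&: kermx C)%MS != 0.
  rewrite -mxrank_eq0 -lt0n; have := mxrank_sum_cap S (kermx C).
  rewrite mxrank_ker => E; rewrite -(ltn_add2l (\rank (S + kermx C)%MS)) addn0 E.
  apply: leq_ltn_trans (rank_leq_col _) _.
  have rm := rank_leq_row C; have rp := rank_leq_col C.
  by rewrite -{1}(subnKC rm) ltn_add2r; exact: leq_ltn_trans pS.
case/rowV0Pn => u; rewrite sub_capmx => /andP[uS /sub_kermxP uC] u0.
by exists u.
Qed.

(** A dimension count.  For a horizontal direction only the previous horizontal
    members, of index at least s = r, give conditions; the vertical ones are
    orthogonal to it anyway. *)
Lemma new_direction k U e : (k < m)%N -> partial_frame k U e ->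
  exists u, [/\ of_kind k x0 u, u != 0 &
    forall a, (a < k)%N -> ip (G x0) u (e a x0) = 0].
Proof.
move=> km [_ Ux0 _ _ kinde _].
have rJ : \rank ('J phi x0) = n by exact/eqP/(sub_full L).
have nm : (n <= m)%N by rewrite -rJ rank_leq_row.
pose s := if (k < r)%N then 0%N else r.
have sk : (s <= k)%N by rewrite /s; case: (ltnP k r).
pose S := if (k < r)%N then ver_space ('J phi x0) else hor_space (G x0) ('J phi x0).
pose C : 'M[R]_(m, k - s) := G x0 *m (\matrix_(i < k - s) e (s + i)%N x0)^T.
have pS : (k - s < \rank S)%N.
  rewrite /s /S; case: (ltnP k r) => kr.
    by rewrite subn0 mxrank_ver_space rJ.
  rewrite mxrank_hor_space ?rJ; [|exact: sub_sym L _ _|exact: sub_unit L _ _].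
  by rewrite ltn_subLR // /r subnK.
have [u [uS uC u0]] := kernel_vector C pS.
have ku : of_kind k x0 u.
  move: uS; rewrite /of_kind /S; case: ifP => _ uS; first exact/verP.
  exact/horP.
exists u; split=> // a ak; case: (leqP s a) => [sa|].
  have as_ : (a - s < k - s)%N by rewrite ltn_sub2rE.
  have := congr1 (fun v : 'rV_(k - s) => v 0 (Ordinal as_)) uC.
  rewrite [RHS]mxE => <-; rewrite /ip mulmxA !mxE; apply: eq_bigr => j _.
  by rewrite !mxE /= subnKC.
rewrite /s; case: (ltnP k r) => // rk ar.
exact: (of_kind_ortho Wx0 ar rk (kinde a x0 ak Ux0) ku).
Qed.

(** One step of the Gram-Schmidt process; the open set shrinks so that the
    orthogonalised field v, which is non-zero at x0, can be normalised. *)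
Lemma extend_frame k U e : (k < m)%N -> partial_frame k U e ->
  exists U' e', partial_frame k.+1 U' e'.
Proof.
move=> km pf; have [u [ku u0 uo]] := new_direction km pf.
have [oU Ux0 UW se kinde oe] := pf.
have [X [sX kX Xx0]] := extend_kind Wx0 ku.
have sG := smooth_on_subset UW (sub_metric_smooth L).
have {}sX := smooth_on_subset UW sX.
pose s := if (k < r)%N then 0%N else r.
pose v x := X x - \sum_(a < k | (s <= a)%N)
  (frame_sign a * ip (G x) (X x) (e a x)) *: e a x.
have sv : smooth_on U v.
  rewrite /v; under [X in smooth_on _ X]eq_fun do rewrite -scaleN1r.
  apply: smooth_on_addmx => //; apply: smooth_on_scalemx => //; first exact: smooth_on_cst.
  apply: smooth_on_summx => // a _; apply: smooth_on_scalemx => //; last exact: se.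
  apply: smooth_onM => //; first exact: smooth_on_cst.
  by apply: smooth_on_ip => //; exact: se.
have kind_s (a : 'I_k) x : (s <= a)%N -> U x -> of_kind k x (e a x).
  move=> sa Ux; have := kinde a x (ltn_ord a) Ux; rewrite /of_kind.
  move: sa; rewrite /s; case: (ltnP k r) => [kr _|rk ra].
    by rewrite (ltn_trans (ltn_ord a) kr).
  by rewrite ltnNge ra.
have kv x : U x -> of_kind k x (v x).
  move=> Ux; apply: of_kindD; first exact: kX (UW _ Ux).
  rewrite -scaleN1r; apply: of_kindZ; apply: of_kind_sum => a sa.
  by apply: of_kindZ; exact: kind_s.
have vo x b : U x -> (b < k)%N -> ip (G x) (v x) (e b x) = 0.
  move=> Ux bk; case: (leqP s b) => [sb|].
    rewrite /v ipBl -big_filter ip_suml big_filter (bigD1 (Ordinal bk)) //= big1 ?addr0.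
      by rewrite oe // eqxx mulrAC frame_sign_sq mul1r subrr.
    move=> a /andP[_ ab]; rewrite oe // (_ : (a == b :> nat) = false) ?mulr0 //.
    by apply: contraNF ab => /eqP ab; apply/eqP/val_inj.
  rewrite /s; case: (ltnP k r) => // rk br.
  apply: (@of_kind_ortho b k); [exact: UW|by []|by []|exact: kinde|exact: kv].
have vx0 : v x0 = u.
  rewrite /v Xx0 big1 ?subr0 // => a _.
  by rewrite uo // mulr0 scale0r.
pose q x := frame_sign k * ip (G x) (v x) (v x).
have sq : smooth_on U q.
  apply: smooth_onM => //; first exact: smooth_on_cst.
  exact: smooth_on_ip.
pose U' := U `&` [set x | 0 < q x].
have oU' : open U'.
  rewrite openE => x [Ux qx]; apply: filterI; first exact: open_nbhs_nbhs.
  have cq : {for x, continuous q}.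
    exact/differentiable_continuous/(smooth_on_diff sq Ux).
  by apply: (cq [set y | 0 < y]); apply: open_nbhs_nbhs; split=> //; exact: open_gt.
have U'U : U' `<=` U by move=> x [].
pose ek x := (Num.sqrt (q x))^-1 *: v x.
pose e' a := if a == k then ek else e a.
have e'k : e' k = ek by rewrite /e' eqxx.
have e'a a : (a < k)%N -> e' a = e a by move=> ak; rewrite /e' (ltn_eqF ak).
have case_k a : (a < k.+1)%N -> a = k \/ (a < k)%N.
  by rewrite ltnS leq_eqVlt => /predU1P.
exists U', e'; constructor.
- exact: oU'.
- split; first exact: Ux0.
  rewrite /= /q vx0; exact: of_kind_sign.
- by move=> x /U'U /UW.
- move=> a /case_k[->|ak].
    rewrite e'k; apply: smooth_on_scalemx => //; last exact: smooth_on_subset sv.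
    apply: smooth_onV => //.
      by apply: smooth_on_sqrt => // [|x []//]; exact: smooth_on_subset sq.
    by move=> x [_ /= qx]; rewrite gt_eqF // sqrtr_gt0.
  by rewrite (e'a _ ak); apply: smooth_on_subset (se _ ak).
- move=> a x /case_k[->|ak] [Ux qx].
    by rewrite e'k; apply: of_kindZ; exact: kv.
  by rewrite (e'a _ ak); exact: kinde.
- have oek x b : U' x -> (b < k)%N -> ip (G x) (ek x) (e b x) = 0.
    by move=> [Ux _] bk; rewrite /ek ipZl vo // mulr0.
  move=> a b x /case_k[->|ak] /case_k[->|bk] U'x.
  + have [Ux /= qx] := U'x; rewrite e'k eqxx /ek ipZl ipZr mulrA -invfM -expr2.
    rewrite sqr_sqrtr; last exact: ltW.
    rewrite mulrC; apply: (canLR (mulfK _)); first by rewrite gt_eqF.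
    by rewrite /q mulrA frame_sign_sq mul1r.
  + by rewrite e'k (e'a _ bk) oek // (gtn_eqF bk).
  + rewrite e'k (e'a _ ak) (ltn_eqF ak) ip_sym; first exact: oek.
    by apply: (sub_sym L); apply: UW; exact: U'U.
  + by rewrite (e'a _ ak) (e'a _ bk); apply: oe => //; exact: U'U.
Qed.

Lemma adapted_frame_exists : exists U eps e,
  [/\ open U, U x0, U `<=` W & adapted_frame G phi r U eps e].
Proof.
suff [U [e [oU Ux0 UW se kinde oe]]] : exists U e, partial_frame m U e.
  exists U, (fun a : 'I_m => frame_sign a), (fun a : 'I_m => e a); split=> //; split.
  - by move=> a; rewrite /frame_sign; case: ifP; [right|left].
  - by move=> a; exact: se.
  - by move=> x a b Ux; rewrite oe.
  - by move=> x a Ux ar; have := kinde a x (ltn_ord a) Ux; rewrite /of_kind ar.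
  - by move=> x a Ux ar; have := kinde a x (ltn_ord a) Ux; rewrite /of_kind ltnNge ar.
suff H k : (k <= m)%N -> exists U e, partial_frame k U e by exact: H.
elim: k => [_|k IH km]; first by exists W, (fun _ => cst 0); split.
by have [U [e pf]] := IH (ltnW km); exact: extend_frame pf.
Qed.

End AdaptedFrame.

(** * Properness and compactness of the total space *)

Section ProperMap.
Context {M B : topologicalType} (f : M -> B).

(** Compact sets form a directed family, along which A is eventually contained in
    the interior because this holds near each of its points. *)
Lemma compact_neighbourhood (A : set M) :
  (forall p : M, exists2 K, compact K & nbhs p K) -> compact A ->
  exists2 K, compact K & A `<=` K^°.
Proof.
move=> loc /compact_near_coveringP cA.
pose F := filter_from [set K0 : set M | compact K0] (fun K0 => [set K | K0 `<=` K]).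
have FF : Filter F.
  apply: filter_from_filter; first by exists set0; exact: compact0.
  move=> K1 K2 cK1 cK2; exists (K1 `|` K2); first exact: compactU.
  by move=> K /= sK; split=> p Kp; apply: sK; [left|right].
have [p Ap|K0 cK0 sK0] := cA _ F (fun K p => K^° p) FF.
  have [K cK Kp] := loc p.
  exists (K^°, [set K1 | K `<=` K1]); last first.
    by move=> [q K1] [/= Kq KK1]; apply: filterS Kq.
  split; last by exists K.
  by apply: open_nbhs_nbhs; split=> //; exact: open_interior.
by exists K0 => // p Ap; exact: (sK0 K0).
Qed.

Hypotheses (cf : continuous f) (hM : hausdorff_space M) (hB : hausdorff_space B).
Hypothesis loc : forall p : M, exists2 K, compact K & nbhs p K.
Hypothesis f_open : forall p A, nbhs p A -> nbhs (f p) (f @` A).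
Hypothesis surj : forall b, exists p, f p = b.
Hypothesis fibre_connected : forall b, connected (f @^-1` [set b]).
Hypothesis fibre_compact : forall b, compact (f @^-1` [set b]).

(** Let K be a compact neighbourhood of the fibre over b.  The fibres over points
    near b avoid the boundary of K, whose image is closed and does not contain b,
    and meet the interior of K because f is open; being connected, they stay in
    the interior. *)
Lemma tube_neighbourhood (b : B) : exists2 K, compact K & \forall b' \near b, f @^-1` [set b'] `<=` K.
Proof.
have [K cK FK] := compact_neighbourhood loc (@fibre_compact b).
exists K => //; pose D := K `\` K^°.
have cD : compact D.
  apply: (subclosed_compact _ cK); last by move=> ? [].
  rewrite /D setDE; apply: closedI; first exact: compact_closed.
  exact/open_closedC/open_interior.
have cfD : closed (f @` D).
  by apply: compact_closed => //; apply: continuous_compact => //; exact: continuous_subspaceT.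
have nD : \forall b' \near b, ~ (f @` D) b'.
  apply: open_nbhs_nbhs; split; first exact: closed_openC.
  by move=> [p [_ nKp] fp]; apply: nKp; exact: FK.
have nK : \forall b' \near b, (f @` K^°) b'.
  have [p fp] := surj b; rewrite -fp; apply: f_open.
  by apply: open_nbhs_nbhs; split; [exact: open_interior|apply: FK].
apply: filterS2 nD nK => b' nD' [p Kp fp].
have <- : (f @^-1` [set b']) `&` K^° = f @^-1` [set b'].
  apply: fibre_connected; first by exists p.
  - by exists K^° => //; exact: open_interior.
  - exists K; first exact: compact_closed.
    apply/seteqP; split=> q [fq Kq]; split=> //; first exact: interior_subset.
    by apply: contrapT => nKq; apply: nD'; exists q.
by move=> q [_ /interior_subset].
Qed.

Lemma compact_total_space : compact [set: B] -> compact [set: M].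
Proof.
rewrite compact_ultra => cB; rewrite compact_ultra => F uF _.
have ufF : UltraFilter (f @ F).
  split=> [|G pG sG]; first exact: fmap_proper_filter.
  apply/seteqP; split=> // A GA.
  have [//|FnA] := in_ultra_setVsetC (f @^-1` A) uF.
  have : G (A `&` ~` A) by apply: filterI => //; exact: sG.
  by rewrite setICr => /filter_not_empty.
have [b [_ /= Fb]] := cB _ ufF filterT.
have [K cK nK] := tube_neighbourhood b.
have FK : F K.
  have : F (f @^-1` [set b' | f @^-1` [set b'] `<=` K]) by exact: Fb.
  by apply: filterS => p /=; apply.
rewrite compact_ultra in cK.
by have [p [_ Fp]] := cK F uF FK; exists p.
Qed.

End ProperMap.

(** * Local surjectivity of submersions *)

Section LocalExtremum.
Context {R : realType} {V : normedModType R}.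

Lemma local_max_derive0 (U : set V) (f : V -> R) x v : open U ->
  (forall y, U y -> differentiable f y) -> U x -> (\forall y \near x, f y <= f x) -> 'D_v f x = 0.
Proof.
move=> oU df Ux max.
have cl : {for (0 : R), continuous (fun s : R => x + s *: v)}.
  by apply: differentiable_continuous.
have nU : \forall s \near (0 : R), U (x + s *: v) /\ f (x + s *: v) <= f x.
  apply: (cl (fun y => U y /\ f y <= f x)); rewrite scale0r addr0.
  by apply: filterI; [exact: open_nbhs_nbhs|exact: max].
have [d /= d0 Bd] := (nbhs_ballP _ _).1 nU.
have inB s : s \in `](- d), d[ -> U (x + s *: v) /\ f (x + s *: v) <= f x.
  rewrite in_itv /= => sd; apply: Bd; rewrite -ball_normE /= sub0r normrN.
  by rewrite ltr_norml.
pose g (s : R) := f (x + s *: v).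
have dg s : s \in `](- d), d[ -> is_derive s 1 g ('D_v f (x + s *: v)).
  by move=> /inB[Us _]; apply: is_derive_line; exact: df.
have d00 : (0 : R) \in `](- d), d[ by rewrite in_itv /= oppr_lt0 d0.
have g0 : is_derive (0 : R) 1 g 0.
  apply: (@derive1_at_max _ g (- d) d) => //.
  - by rewrite ge0_cp // ltW.
  - by move=> s /dg [].
  - by move=> s /inB[_ fs]; rewrite /g scale0r addr0.
have := dg 0 d00; rewrite scale0r addr0 => g0'.
by rewrite -(@derive_val _ _ _ _ _ _ _ g0') (@derive_val _ _ _ _ _ _ _ g0).
Qed.

End LocalExtremum.

Section LocalSurjectivity.
Context {R : realType}.

Lemma coord_le_norm n (u : 'rV[R]_n) j : `|u 0 j| <= `|u|.
Proof.
rewrite [leRHS]/Num.Def.normr /= mx_normrE.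
exact: (le_bigmax _ (fun i : 'I_1 * 'I_n => `|u i.1 i.2|) (0, j)).
Qed.

(** The norm of row vectors is the maximum norm; the Euclidean one is used where
    differentiability is needed. *)
Lemma ip1E n (u : 'rV[R]_n) : ip 1%:M u u = \sum_j u 0 j ^+ 2.
Proof. by rewrite /ip mulmx1 mxE; apply: eq_bigr => j _; rewrite mxE expr2. Qed.

Lemma ip1_ge0 n (u : 'rV[R]_n) : 0 <= ip 1%:M u u.
Proof. by rewrite ip1E; apply: sumr_ge0 => j _; exact: sqr_ge0. Qed.

Lemma ip1_eq0 n (u : 'rV[R]_n) : ip 1%:M u u = 0 -> u = 0.
Proof.
rewrite ip1E => /eqP; rewrite psumr_eq0 => [/allP u0|j _]; last exact: sqr_ge0.
apply/rowP => j; rewrite mxE; apply/eqP; rewrite -sqrf_eq0.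
exact: (u0 j (mem_index_enum _)).
Qed.

Lemma ip1_le n (u : 'rV[R]_n) : ip 1%:M u u <= n%:R * `|u| ^+ 2.
Proof.
have -> : n%:R * `|u| ^+ 2 = \sum_(j < n) `|u| ^+ 2.
  by rewrite sumr_const card_ord mulr_natl.
rewrite ip1E; apply: ler_sum => j _.
by rewrite -real_normK ?num_real // lerXn2r ?nnegrE // coord_le_norm.
Qed.

Lemma ip1_ge n (u : 'rV[R]_n) : `|u| ^+ 2 <= ip 1%:M u u.
Proof.
have [->|u0] := eqVneq u 0; first by rewrite normr0 expr0n ip1_ge0.
have [|[i j] E] := @mx_norm_neq0 _ _ _ u.
  by rewrite -[mx_norm u]/(`|u|) normr_eq0.
rewrite -[mx_norm u]/(`|u|) /= in E; rewrite E ord1 real_normK ?num_real // ip1E.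
by rewrite (bigD1 j) //= lerDl; apply: sumr_ge0 => k _; exact: sqr_ge0.
Qed.

Lemma derive_ip1 (V : normedModType R) n (g : V -> 'rV[R]_n) a v : differentiable g a ->
  'D_v (fun b => ip 1%:M (g b) (g b)) a = 2 * ip 1%:M ('D_v g a) (g a).
Proof.
move=> dg; have dgt := differentiable_tr dg.
rewrite (_ : (fun b => _) = (fun b => (g b *m (g b)^T) 0 0)); last first.
  by apply/funext => b; rewrite /ip mulmx1.
rewrite -derive_mxE; last exact: differentiable_mulmx.
rewrite derive_mulmx // derive_tr // mxE mulr_natl mulr2n.
congr (_ + _); first by rewrite /ip mulmx1.
by rewrite ip_sym ?trmx1 // /ip mulmx1.
Qed.

Lemma differentiable_ip1 (V : normedModType R) n (g : V -> 'rV[R]_n) a :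
  differentiable g a -> differentiable (fun b => ip 1%:M (g b) (g b) : R) a.
Proof.
move=> dg; rewrite (_ : (fun b => _) = (fun b => (g b *m (g b)^T) 0 0)).
  have := differentiable_mulmx dg (differentiable_tr dg).
  by move/differentiable_mxP; apply.
by apply/funext => b; rewrite /ip mulmx1.
Qed.

(** If C / 2 is a Lipschitz constant of the inverse of the differential at 0, then
    a remainder of size at most |a| / C near 0 can be absorbed. *)
Lemma linear_expansion n (psi : 'rV[R]_n -> 'rV[R]_n) : differentiable psi 0 ->
  'J psi 0 \in unitmx -> exists2 C : R, 0 < C &
  \forall a \near (0 : 'rV[R]_n), `|a| <= C * `|psi a - psi 0|.
Proof.
move=> dpsi; set K := 'J psi 0 => Ku.
have [|C C0 lip] := @linear_lipschitz _ _ _ (mulmxr (invmx K) : {linear 'rV[R]_n -> 'rV[R]_n}).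
  move=> b; apply: differentiable_continuous.
  by apply: (@differentiable_mulmx _ _ _ _ _ id (cst (invmx K))).
exists (2 * C); first by rewrite mulr_gt0.
have e0 : 0 < (2 * C)^-1 by rewrite invr_gt0 mulr_gt0.
have /diff_locallyP[_ /eqaddoP /(_ _ e0)] := dpsi.
apply: filterS => a.
change (`|psi (a + 0) - (psi 0 + 'd psi 0 a)| <= (2 * C)^-1 * `|a| -> `|a| <= 2 * C * `|psi a - psi 0|).
rewrite addr0 -deriveE // -mul_jacobian // -/K => psiE.
have aK : `|a| <= C * `|a *m K| by rewrite -{1}(mulmxK Ku a); exact: lip.
have : `|a *m K| <= `|psi a - psi 0| + (2 * C)^-1 * `|a|.
  rewrite -[a *m K](subrK (psi a - psi 0)) addrC.
  apply: le_trans (ler_normD _ _) _; rewrite lerD2l distrC.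
  by rewrite -addrA -opprD in psiE *.
rewrite -(ler_pM2l C0) => /(le_trans aK).
have CE : C * ((2 * C)^-1 * `|a|) = `|a| / 2 by field; rewrite gt_eqF.
by rewrite mulrDr CE; lra.
Qed.

(** On the slice l through x0 spanned by the gradients, phi becomes a map psi
    between spaces of the same dimension, with invertible differential at 0.  For
    y close to phi x0, the squared distance F from psi to y attains its minimum
    over a small ball at an interior point, because F is smaller at the centre
    than on the sphere; the critical point equation and the invertibility of the
    differential then force psi = y there. *)
Lemma submersion_locally_surjective m n (U : set 'rV[R]_m) (phi : 'rV[R]_m -> 'rV[R]_n)
    x0 (A : set 'rV[R]_m) : open U -> smooth_on U phi -> U x0 ->
  row_full ('J phi x0) -> nbhs x0 A -> nbhs (phi x0) (phi @` A).
Proof.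
move=> oU sphi Ux0 Jfull nA; set J := 'J phi x0 in Jfull.
pose l (a : 'rV[R]_n) : 'rV[R]_m := x0 + a *m J^T.
have l0 : l 0 = x0 by rewrite /l mul0mx addr0.
have dl a : differentiable l a.
  apply: differentiableD => //.
  by apply: (@differentiable_mulmx _ _ _ _ _ id (cst J^T)).
have Jl a : 'J l a = J^T.
  apply: mulmx_ext => v; rewrite mul_jacobian //.
  have dm : differentiable (fun a : 'rV[R]_n => a *m J^T) a.
    by apply: (@differentiable_mulmx _ _ _ _ _ id (cst J^T)).
  rewrite /l deriveD ?derive_cst ?add0r; [|by []|exact: diff_derivable].
  rewrite (@derive_mulmx _ _ _ _ _ id (cst J^T)) // derive_id derive_cst.
  by rewrite mulmx0 addr0.
have Ku : J^T *m J \in unitmx.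
  rewrite -row_free_unit -kermx_eq0; apply/rowV0P => a /sub_kermxP aK.
  apply: (full_tr_inj Jfull); apply: ip1_eq0.
  by rewrite /ip mulmx1 trmx_mul trmxK mulmxA -[a *m _ *m _]mulmxA aK mul0mx mxE.
pose psi a := phi (l a).
have cl : l @ (0 : 'rV[R]_n) --> x0 by rewrite -l0; exact: (differentiable_continuous (dl 0)).
have psiP a : U (l a) -> differentiable psi a /\ 'J psi a = J^T *m 'J phi (l a).
  move=> Ua; have dphi := smooth_on_diff sphi Ua; split.
    exact: (@differentiable_comp _ _ _ _ l phi).
  by rewrite -(Jl a); exact: jacobian_comp.
have [dpsi0 Jpsi0] : differentiable psi 0 /\ 'J psi 0 = J^T *m J.
  by have := psiP 0; rewrite l0; apply.
have [|C C0 expand] := linear_expansion dpsi0; first by rewrite Jpsi0.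
have nl : \forall a \near (0 : 'rV[R]_n), U (l a) /\ A (l a).
  apply: (near_comp (P := fun y => U y /\ A y) cl).
  by apply: filterI nA; exact: open_nbhs_nbhs.
have ndet : \forall a \near (0 : 'rV[R]_n), J^T *m 'J phi (l a) \in unitmx.
  have sJ := smooth_on_jacobian oU sphi.
  have sd : smooth_on U (fun x => \det (J^T *m 'J phi x)).
    by apply: smooth_on_det => //; apply: smooth_on_mulmx => //; exact: smooth_on_cst.
  have cd : {for x0, continuous (fun x => \det (J^T *m 'J phi x))}.
    exact: differentiable_continuous (smooth_on_diff sd Ux0).
  have d0 : \det (J^T *m J) != 0 by rewrite -unitfE -unitmxE.
  have nd : \forall x \near x0, \det (J^T *m 'J phi x) != 0.
    apply: (near_comp (P := fun t : R => t != 0) cd).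
    by apply: open_nbhs_nbhs; split=> //; exact: open_neq.
  apply: filterS (near_comp cl nd) => a.
  by rewrite unitmxE unitfE.
have [d /= d0 Bd] := (nbhs_ballP _ _).1 (filterI (filterI nl ndet) expand).
have inB a : `|a| < d -> [/\ U (l a), A (l a), J^T *m 'J phi (l a) \in unitmx &
    `|a| <= C * `|psi a - psi 0|].
  move=> ad; have [|[[Ua Aa] Ja] Ea] := Bd a; last by split.
  by rewrite -ball_normE /= sub0r normrN.
pose rho := d / 2; have rho0 : 0 < rho by rewrite divr_gt0.
have rhod : rho < d by rewrite ltr_pdivrMr // ltr_pMr // ltr1n.
(* On the sphere, psi - y has norm at least rho / C - delta = (1 + n) delta, and
   (1 + n)^2 > n, where n compares the Euclidean and the maximum norms. *)
pose delta := rho / C / (2 + n%:R).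
have n2 : (0 : R) < 2 + n%:R by rewrite ltr_pwDl.
have delta0 : 0 < delta by rewrite !divr_gt0.
apply/nbhs_ballP; exists delta => //= y; rewrite -ball_normE /= => yd.
pose F a := ip 1%:M (psi a - y) (psi a - y).
have dF a : `|a| < d -> differentiable F a.
  move=> /inB[/psiP[da _] _ _ _]; apply: differentiable_ip1.
  exact: differentiableB.
pose S : set 'rV[R]_n := [set a | `|a| <= rho].
have S0 : S 0 by rewrite /S /= normr0 ltW.
have cS : compact S.
  apply: bounded_closed_compact.
    exists rho; split; first exact: num_real.
    by move=> t rt a /le_trans; apply; exact: ltW.
  have : closed ((fun a : 'rV[R]_n => `|a|) @^-1` [set t | t <= rho]).
    by apply: preimage_closed; [move=> a _; exact: norm_continuous|exact: closed_le].
  by [].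
have [|a /set_mem Sa minF] := @EVT_min_rV R n F S (ex_intro _ 0 S0) cS.
  apply: continuous_in_subspaceT => a /set_mem Sa; apply: differentiable_continuous.
  by apply: dF; exact: le_lt_trans rhod.
have arho : `|a| < rho.
  rewrite lt_neqAle (Sa : `|a| <= rho) andbT; apply/eqP => aE.
  have [_ _ _ Ea] := inB a (le_lt_trans Sa rhod).
  have F0 := minF 0 (mem_set S0).
  have F0le : F 0 <= n%:R * delta ^+ 2.
    apply: le_trans (ip1_le _) _; rewrite ler_wpM2l // lerXn2r ?nnegrE //; first exact: ltW.
    by rewrite /psi l0 ltW.
  have psia : (1 + n%:R) * delta <= `|psi a - y|.
    have E1 : rho / C <= `|psi a - psi 0| by rewrite ler_pdivrMr // mulrC -aE.
    have E2 : `|psi a - psi 0| <= `|psi a - y| + delta.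
      apply: le_trans (ler_distD y _ _) _; rewrite lerD2l distrC /psi l0.
      exact: ltW.
    have E3 : rho / C = (2 + n%:R) * delta by rewrite [RHS]mulrC /delta divfK ?gt_eqF.
    by rewrite E3 in E1; lra.
  have Fa : ((1 + n%:R) * delta) ^+ 2 <= F a.
    apply: le_trans (ip1_ge _); rewrite lerXn2r ?nnegrE //.
    by rewrite mulr_ge0 ?ltW // ltr_pwDl.
  have := le_trans Fa (le_trans F0 F0le).
  rewrite exprMn ler_pM2r ?exprn_gt0 //.
  have : (0 : R) <= n%:R by [].
  by move=> n0; nra.
have ad := lt_trans arho rhod.
have [Ua Aa Ja _] := inB a ad.
have [da Jpsia] := psiP a Ua.
exists (l a) => //; apply/eqP; rewrite -subr_eq0; apply/eqP.
have oD : open [set b : 'rV[R]_n | `|b| < d].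
  have : open ((fun a : 'rV[R]_n => `|a|) @^-1` [set t | t < d]).
    by apply: open_comp; [move=> b _; exact: norm_continuous|exact: open_lt].
  by [].
have crit v : ip 1%:M (v *m 'J psi a) (psi a - y) = 0.
  have := @local_max_derive0 _ _ _ (fun b => - F b) a v oD.
  rewrite deriveN; last by apply: diff_derivable; exact: dF.
  rewrite derive_ip1; last exact: differentiableB.
  rewrite deriveB ?derive_cst ?subr0; [|exact: diff_derivable|by []].
  rewrite mul_jacobian // => H.
  have /eqP : - (2 * ip 1%:M ('D_v psi a) (psi a - y)) = 0.
    apply: H => //; first by move=> b /dF dFb; exact: differentiableN.
    have oR : open [set b : 'rV[R]_n | `|b| < rho].
      have : open ((fun a : 'rV[R]_n => `|a|) @^-1` [set t | t < rho]).
        by apply: open_comp; [move=> b _; exact: norm_continuous|exact: open_lt].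
      by [].
    apply: (near_open oR) => // b bS; rewrite lerN2; apply: minF; apply/mem_set.
    exact: ltW.
  by rewrite oppr_eq0 mulf_eq0 pnatr_eq0 /= => /eqP.
apply: ip1_eq0; rewrite -{1}(mulmxKV Ja (phi (l a) - y)) -Jpsia.
exact: crit.
Qed.

End LocalSurjectivity.

(** * From charts to manifolds *)

Section Manifolds.
Context {R : realType}.

Lemma submersion_on_subset m n (W U : set 'rV[R]_m) G (phi : 'rV[R]_m -> 'rV[R]_n) G' :
  open U -> U `<=` W -> submersion_on W G phi G' -> submersion_on U G phi G'.
Proof.
move=> oU UW [oW sG sphi Gs Gu full nd dG' G's iso]; constructor.
- exact: oU.
- exact: smooth_on_subset sG.
- exact: smooth_on_subset sphi.
- by move=> x /UW; exact: Gs.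
- by move=> x /UW; exact: Gu.
- by move=> x /UW; exact: full.
- by move=> x u /UW; exact: nd.
- by move=> x /UW; exact: dG'.
- by move=> x /UW; exact: G's.
- by move=> x u w /UW; exact: iso.
Qed.

Lemma open_preimage_chart m (T : topologicalType) (c : chart R m T) (A : set T) :
  open A -> open [set x | target c x /\ A (point_at c x)].
Proof.
move=> oA; rewrite openE => x [tx Ax]; apply: filterI.
  by apply: open_nbhs_nbhs; split=> //; exact: target_open.
apply: (near_comp (P := A) (point_at_continuous tx)).
exact: open_nbhs_nbhs.
Qed.

Lemma open_overlap m (T : topologicalType) (c c' : chart R m T) : open (overlap c c').
Proof. by apply: open_preimage_chart; exact: source_open. Qed.

Lemma manifold_locally_compact m (M : manifold R m) (p : M) :
  exists2 K, compact K & nbhs p K.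
Proof.
have [c _ cp] := atlas_cover p; pose x := Defs.coord c p.
have tx : target c x by exact: coord_target.
have /nbhs_ballP[d /= d0 Bd] : nbhs x (target c).
  by apply: open_nbhs_nbhs; split=> //; exact: target_open.
pose S := [set y | `|x - y| <= d / 2].
have d2 : d / 2 < d by rewrite ltr_pdivrMr // ltr_pMr // ltr1n.
have St : S `<=` target c.
  by move=> y /= Sy; apply: Bd; rewrite -ball_normE /=; exact: le_lt_trans Sy d2.
have cS : compact S.
  apply: bounded_closed_compact; last first.
    have -> : S = closed_ball_ (fun y : 'rV[R]_m => `|y|) x (d / 2) by [].
    exact: closed_closed_ball_.
  exists (`|x| + d / 2); split; first exact: num_real.
  move=> t /ltW xt y /= Sy; apply: le_trans xt.
  by rewrite -lerBlDl; apply: le_trans Sy; rewrite distrC; exact: lerB_dist.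
exists (point_at c @` S).
  apply: continuous_compact cS; apply: continuous_in_subspaceT => y /set_mem Sy.
  exact: point_at_continuous (St _ Sy).
have nS : \forall q \near p, S (Defs.coord c q).
  apply: (near_comp (P := S) (Defs.coord_continuous cp)).
  apply/nbhs_ballP; exists (d / 2) => /=; first by rewrite divr_gt0.
  by move=> y; rewrite -ball_normE /= => /ltW.
have ns : \forall q \near p, source c q.
  by apply: open_nbhs_nbhs; split=> //; exact: source_open.
by apply: filterS2 nS ns => q Sq cq; exists (Defs.coord c q) => //; exact: coordK.
Qed.

Lemma transition_jacobian_unit m (M : manifold R m) (g : metric M) (c c' : chart R m M) x :
  atlas M c -> atlas M c' -> overlap c c' x -> 'J (transition c c') x \in unitmx.
Proof.
move=> ac ac' ox; have := gram_nondegenerate g ac ox.1.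
by rewrite (gram_change g ac ac' ox) !unitmx_mul => /andP[/andP[]].
Qed.

End Manifolds.

Section SubmersionCharts.
Context {R : realType} {m n : nat}.
Variables (M : manifold R m) (g : metric M) (B : manifold R n) (g' : metric B).
Variable f : M -> B.
Hypothesis hf : semi_riemannian_submersion g g' f.
Implicit Types (c : chart R m M) (d : chart R n B).

Lemma open_local_domain c d : open (local_domain f c d).
Proof.
have [cf _] := submersion_smooth hf.
have oA : open (f @^-1` source d) by apply: open_comp; [move=> p _; exact: cf|exact: source_open].
exact: (open_preimage_chart oA).
Qed.

Lemma local_submersion c d : atlas M c -> atlas B d ->
  submersion_on (local_domain f c d) (gram g c) (local_map f c d) (gram g' d).
Proof.
move=> ac ad; have [_ sf] := submersion_smooth hf.
have td x : local_domain f c d x -> target d (local_map f c d x).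
  by move=> [_ sx]; exact: coord_target.
constructor.
- exact: open_local_domain.
- by apply: smooth_on_subset (gram_smooth g ac) => x [].
- exact: sf.
- by move=> x [tx _]; exact: gram_sym.
- by move=> x [tx _]; exact: gram_nondegenerate.
- by move=> x; exact: (submersion_full hf).
- by move=> x u; exact: (submersion_nondegenerate hf).
- by move=> x /td tx; exact: smooth_on_diff (gram_smooth g' ad) tx.
- by move=> x /td tx; exact: gram_sym.
- by move=> x u w; exact: (submersion_isometry hf).
Qed.

Lemma submersion_open_map p (A : set M) : nbhs p A -> nbhs (f p) (f @` A).
Proof.
move=> nA; have [c ac cp] := atlas_cover p; have [d ad dp] := atlas_cover (f p).
have L := local_submersion ac ad; set phi := local_map f c d in L.
pose x := Defs.coord c p; have xK : point_at c x = p by exact: coordK.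
have Ux : local_domain f c d x by split; [exact: coord_target|rewrite xK].
have nA' : nbhs x (local_domain f c d `&` [set y | A (point_at c y)]).
  apply: filterI; first by apply: open_nbhs_nbhs; split=> //; exact: open_local_domain.
  apply: (near_comp (P := A) (point_at_continuous Ux.1)).
  by rewrite xK.
have := submersion_locally_surjective (sub_open L) (sub_map_smooth L) Ux
  (sub_full L Ux) nA'.
have phix : phi x = Defs.coord d (f p) by rewrite /phi /local_map /= xK.
rewrite phix => nphi.
have n1 : \forall b \near f p, (phi @` (local_domain f c d `&` [set y | A (point_at c y)])) (Defs.coord d b).
  exact: (near_comp (Defs.coord_continuous dp) nphi).
have n2 : \forall b \near f p, source d b.
  by apply: open_nbhs_nbhs; split=> //; exact: source_open.
apply: filterS2 n1 n2 => b [y [[ty sy] Ay] yb] db.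
exists (point_at c y) => //.
by rewrite -(coordK db) -yb /phi /local_map /= coordK.
Qed.

Lemma total_space_compact : compact [set: B] ->
  (forall b : B, connected (fibre f b)) -> (forall b : B, compact (fibre f b)) ->
  compact [set: M].
Proof.
move=> cB fconn fcomp; have [cf _] := submersion_smooth hf.
apply: (@compact_total_space _ _ f) cB => //.
- exact: manifold_hausdorff.
- exact: manifold_hausdorff.
- exact: manifold_locally_compact.
- exact: submersion_open_map.
- exact: (submersion_surj hf).
Qed.

Hypothesis hB : riemannian g'.

Lemma horizontal_positive c d x u : atlas M c -> atlas B d -> local_domain f c d x ->
  hor (gram g c x) ('J (local_map f c d) x) u -> u != 0 -> 0 < ip (gram g c x) u u.
Proof.
move=> ac ad Ux hu u0; have L := local_submersion ac ad.
rewrite -(sub_isom L Ux hu hu); apply: (hB ad).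
  by move: Ux => [_ sx]; exact: coord_target.
by apply: contra_neq u0 => uJ; exact: (sub_nondeg L Ux).
Qed.

Hypothesis hM : metric_index g (m - n).

Lemma vertical_negative c d x u : atlas M c -> atlas B d -> local_domain f c d x ->
  ver ('J (local_map f c d) x) u -> u != 0 -> ip (gram g c x) u u < 0.
Proof.
move=> ac ad Ux vu u0; have L := local_submersion ac ad.
apply: (@ver_negative _ _ _ _ ('J (local_map f c d) x)) => //.
- exact: (sub_sym L Ux).
- exact: (sub_unit L Ux).
- exact: (sub_full L Ux).
- by move=> w; exact: (sub_nondeg L Ux).
- by move=> w; exact: horizontal_positive ac ad Ux.
- exact: hM ac Ux.1.
Qed.

Lemma frame_exists (p : M) : exists e : local_frame g f (m - n), frame_around p e.
Proof.
have [c ac cp] := atlas_cover p; have [d ad dp] := atlas_cover (f p).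
have L := local_submersion ac ad.
pose x := Defs.coord c p; have xK : point_at c x = p by exact: coordK.
have Ux : local_domain f c d x by split; [exact: coord_target|rewrite xK].
have [U [eps [e [oU U0 UW ae]]]] := adapted_frame_exists L
  (fun y u Uy => @horizontal_positive c d y u ac ad Uy)
  (fun y u Uy => @vertical_negative c d y u ac ad Uy) Ux.
by exists (LocalFrame ac ad oU UW ae).
Qed.

End SubmersionCharts.

Section UmbilicFrames.
Context {R : realType} {m n : nat}.
Variables (M : manifold R m) (g : metric M) (B : manifold R n) (g' : metric B).
Variable f : M -> B.
Local Notation r := (m - n)%N.
Hypothesis hf : semi_riemannian_submersion g g' f.
Hypothesis hB : riemannian g'.
Hypothesis hM : metric_index g r.
Hypothesis humb : totally_umbilic_fibres g f r.
Hypothesis r0 : (0 < r)%N.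

Section OneFrame.
Variable e : local_frame g f r.
Let W := fr_dom e.
Let G := gram g (fr_chart e).
Let phi := local_map f (fr_chart e) (fr_base e).
Let ac := fr_chart_atlas e.
Let ad := fr_base_atlas e.

Lemma frame_submersion : submersion_on W G phi (gram g' (fr_base e)).
Proof.
apply: submersion_on_subset (local_submersion hf ac ad); first exact: fr_open.
by move=> x Wx; exact: fr_sub.
Qed.
Let L := frame_submersion.

(** The second term of T vanishes, since a vertical field has horizontal part 0 near
    the point. *)
Lemma oneillT_vertical U V x : W x ->
  (forall y, W y -> vertical phi y (U y)) -> (forall y, W y -> vertical phi y (V y)) ->
  oneillT G phi U V x = nabla G U V x *m hproj (G x) ('J phi x).
Proof.
move=> Wx vU vV; rewrite /oneillT.
have vpE E : (forall y, W y -> vertical phi y (E y)) -> \forall y \near x, vpart G phi E y = E y.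
  move=> vE; apply: (near_open (sub_open L) Wx) => y Wy.
  by apply: vproj_ver; [move=> u; exact: (sub_nondeg L Wy)|exact: vE].
have hp0 : \forall y \near x, hpart G phi V y = 0.
  apply: (near_open (sub_open L) Wx) => y Wy.
  by apply: hproj_ver; [move=> u; exact: (sub_nondeg L Wy)|exact: vV].
rewrite (_ : vpart _ _ _ _ = 0) ?addr0.
  rewrite /hpart; congr (_ *m _); apply: near_eq_nabla; last exact: vpE.
  exact: nbhs_singleton (vpE _ vU).
rewrite /vpart (_ : nabla _ _ _ _ = 0) ?mul0mx //.
rewrite (@near_eq_nabla _ _ _ _ U _ (cst 0)) //; last exact: nbhs_singleton (vpE _ vU).
rewrite nablaE derive_cst add0r big1 // => i _; rewrite big1 // => j _.
by rewrite mxE mulr0 scale0r.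
Qed.

Definition frame_N x : 'rV[R]_m := r%:R^-1 *: frame_H e x.

Lemma sqnorm_HE p : sqnorm_H e p =
  ip (G (Defs.coord (fr_chart e) p)) (frame_N (Defs.coord (fr_chart e) p))
    (frame_N (Defs.coord (fr_chart e) p)).
Proof. by []. Qed.

(** The first member of the frame, which is vertical because r > 0. *)
Lemma frame_unit_ver : exists V : 'rV[R]_m -> 'rV[R]_m, [/\ smooth_on W V,
  forall y, W y -> ver ('J phi y) (V y) & forall y, W y -> ip (G y) (V y) (V y) = -1].
Proof.
have m0 : (0 < m)%N := leq_trans r0 (leq_subr n m).
have [eps1 se oe ve _] := fr_adapted e.
exists (fr_field e (Ordinal m0)); split=> [|y Wy|y Wy]; first exact: se.
  exact: ve.
have vy : ver ('J phi y) (fr_field e (Ordinal m0) y) by exact: ve.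
have := vertical_negative hf hB hM ac ad (fr_sub Wy) vy.
rewrite oe // eqxx; have [->|//] := eps1 (Ordinal m0).
have u0 : fr_field e (Ordinal m0) y != 0.
  apply/eqP => u0; have := oe y (Ordinal m0) (Ordinal m0) Wy.
  rewrite u0 ip0l eqxx => E; have := eps1 (Ordinal m0).
  by rewrite -E => -[/eqP|/eqP]; rewrite eq_sym ?oppr_eq0 oner_eq0.
by move=> /(_ u0); rewrite ltr10.
Qed.

(** The frame vector H is the horizontal part of - r nabla_V V for a unit vertical
    field V; this is how its smoothness is obtained. *)
Lemma frame_umbilic : umbilic_on W G phi frame_N.
Proof.
have [V [sV vV uV]] := frame_unit_ver.
have NE U U' x : W x -> smooth_on W U -> smooth_on W U' ->
    (forall y, W y -> ver ('J phi y) (U y)) -> (forall y, W y -> ver ('J phi y) (U' y)) ->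
    nabla G U U' x *m hproj (G x) ('J phi x) = ip (G x) (U x) (U' x) *: frame_N x.
  move=> Wx sU sU' vU vU'; rewrite -oneillT_vertical //.
  rewrite (humb sU sU' vU vU' Wx) -/W -/G -/phi /frame_N scalerA mulrC.
  by rewrite mulrC.
have NV x : W x -> frame_N x = (-1) *: (nabla G V V x *m hproj (G x) ('J phi x)).
  by move=> Wx; rewrite (NE V V) // uV // scalerA mulrNN mulr1 scale1r.
have [oW sG _ Gs Gu _ _ _ _ _] := L.
constructor.
- apply: (@eq_smooth_on _ _ _ _ oW
    (fun x => (-1) *: (nabla G V V x *m hproj (G x) ('J phi x)))).
    by move=> x Wx; rewrite NV.
  apply: smooth_on_scalemx => //; first exact: smooth_on_cst.
  by apply: (smooth_on_hpart L); exact: smooth_on_nabla.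
- by move=> x Wx; rewrite NV //; apply: horZ; exact: hor_hproj.
- move=> U U' x w Wx sU sU' vU vU' hw.
  by rewrite -(ip_hpartl L _ Wx hw) NE // ipZl.
Qed.

End OneFrame.

Lemma sqnorm_H_frame_independent p (e e' : local_frame g f r) :
  frame_around p e -> frame_around p e' -> sqnorm_H e p = sqnorm_H e' p.
Proof.
move=> [cp Wp] [c'p W'p]; rewrite !sqnorm_HE.
set C := fr_chart e in cp Wp *; set C' := fr_chart e' in c'p W'p *.
pose x := Defs.coord C p; have xK : point_at C x = p by exact: coordK.
have ac : atlas M C := fr_chart_atlas e; have ac' : atlas M C' := fr_chart_atlas e'.
have ad := fr_base_atlas e; have ad' := fr_base_atlas e'.
have tx : transition C C' x = Defs.coord C' p by rewrite /transition /= xK.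
have Ox : overlap C C' x by split; [exact: coord_target|rewrite xK].
have [stau ssig] := atlas_compatible ac ac'.
have oO : open (overlap C C') by exact: open_overlap.
have oO' : open (overlap C' C) by exact: open_overlap.
have [V [sV vV uV]] := frame_unit_ver e.
have nO : \forall y \near x, overlap C C' y := near_open oO Ox (fun _ => id).
have sigO y : overlap C C' y -> overlap C' C (transition C C' y).
  move=> [ty sy]; split; first exact: coord_target.
  by rewrite /transition /= coordK //; exact: point_at_source.
have trK y : overlap C C' y -> transition C' C (transition C C' y) = y.
  by move=> [ty sy]; rewrite /transition /= coordK // point_atK.
have nW : \forall y \near x, fr_dom e y := near_open (sub_open (frame_submersion e)) Wp (fun _ => id).
have dtau y : overlap C C' y -> differentiable (transition C C') y.
  exact: smooth_on_diff stau.
have nW' : \forall y \near x, fr_dom e' (transition C C' y).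
  apply: (near_comp (P := fr_dom e') (differentiable_continuous (dtau x Ox))).
  by apply: open_nbhs_nbhs; split; [exact: fr_open|rewrite tx].
have base_overlap y : overlap C C' y -> fr_dom e y -> fr_dom e' (transition C C' y) ->
    overlap (fr_base e) (fr_base e') (local_map f C (fr_base e) y).
  move=> [ty sy] Wy W'y; have [_ dy] := fr_sub Wy; have [_ d'y] := fr_sub W'y.
  split; first exact: coord_target.
  by move: d'y; rewrite /local_map /transition /= coordK // coordK.
rewrite -tx; apply/esym.
apply: (@mean_curvature_invariant _ _ _ (fr_dom e) (fr_dom e') (overlap C C')
  (gram g C) (gram g C') _ _ _ _ (transition C C') (transition C' C) x
  (frame_N e) (frame_N e') V (-1) (frame_submersion e) (frame_submersion e')
  (frame_umbilic e) (frame_umbilic e')) => //.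
- by rewrite tx.
- apply: smooth_on_diff ssig _; exact: sigO.
- by apply: filterS nO => y /trK.
- have O'x : overlap C' C (transition C C' x) by exact: sigO.
  apply: (near_open oO' O'x) => z [tz sz].
  by rewrite /transition /= coordK // point_atK.
- by apply: filterS nO => y; exact: gram_change.
- apply: filterS3 nO nW nW' => y Oy Wy W'y w.
  set phi := local_map _ _ _; set phi' := local_map _ _ _.
  have Ly := fr_sub Wy; have L'y := fr_sub W'y.
  have dphi : differentiable phi y := smooth_on_diff (sub_map_smooth (frame_submersion e)) Wy.
  have dphi' : differentiable phi' (transition C C' y) :=
    smooth_on_diff (sub_map_smooth (frame_submersion e')) W'y.
  have E : 'J (transition C C') y *m 'J phi' (transition C C' y) =
      'J phi y *m 'J (transition (fr_base e) (fr_base e')) (phi y).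
    have [sth _] := atlas_compatible ad ad'.
    have Oth := base_overlap y Oy Wy W'y.
    have dth := smooth_on_diff sth Oth.
    rewrite -(jacobian_comp (dtau y Oy) dphi') -(jacobian_comp dphi dth).
    apply: near_eq_jacobian; first exact: differentiable_comp (dtau y Oy) dphi'.
    have nOy : \forall z \near y, overlap C C' z := near_open oO Oy (fun _ => id).
    have nWy : \forall z \near y, fr_dom e z :=
      near_open (sub_open (frame_submersion e)) Wy (fun _ => id).
    apply: filterS2 nOy nWy => z [tz sz] Wz; have [_ dz] := fr_sub Wz.
    by rewrite /phi /phi' /local_map /transition /= coordK // coordK.
  have Jth : 'J (transition (fr_base e) (fr_base e')) (phi y) \in unitmx.
    exact: (transition_jacobian_unit g' ad ad' (base_overlap y Oy Wy W'y)).
  split=> vw; rewrite /ver.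
    by rewrite -mulmxA E mulmxA (vw : w *m _ = 0) mul0mx.
  by rewrite -[LHS](mulmxK Jth) -(mulmxA w ('J phi y)) -E mulmxA (vw : _ *m _ = 0) mul0mx.
- exact: uV.
Qed.

End UmbilicFrames.

(** * The maximum principle *)

Section Rigidity.
Context {R : realType} {m n : nat}.
Variables (M : manifold R m) (g : metric M) (B : manifold R n) (g' : metric B).
Variables (f : M -> B) (c : R).
Local Notation r := (m - n)%N.
Hypothesis hf : semi_riemannian_submersion g g' f.
Hypothesis hB : riemannian g'.
Hypothesis hM : metric_index g r.
Hypothesis hcurv : constant_curvature g c.
Hypothesis humb : totally_umbilic_fibres g f r.
Hypothesis r0 : (0 < r)%N.

Section OneFrame.
Variable e : local_frame g f r.
Let W := fr_dom e.
Let G := gram g (fr_chart e).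
Let phi := local_map f (fr_chart e) (fr_base e).
Let N := frame_N e.
Let L : submersion_on W G phi (gram g' (fr_base e)) := frame_submersion hf e.
Let umb : umbilic_on W G phi N := frame_umbilic hf hB hM humb r0 e.

Lemma frame_horizontal_ge0 x u : W x -> hor (G x) ('J phi x) u -> 0 <= ip (G x) u u.
Proof.
move=> Wx hu; have [->|u0] := eqVneq u 0; first by rewrite ip0l.
apply: ltW.
exact: (horizontal_positive hf hB (fr_chart_atlas e) (fr_base_atlas e) (fr_sub Wx) hu u0).
Qed.

(** [mixed_curvature] with eps = -1, where g(A_X V, A_X V) >= 0 is dropped. *)
Lemma frame_mixed_curvature X x : W x -> smooth_on W X ->
  (forall y, W y -> hor (G y) ('J phi y) (X y)) ->
  ip (G x) (N x) (X x) ^+ 2 + c * ip (G x) (X x) (X x) <=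
  'D_(X x) (fun y => ip (G y) (N y) (X y)) x - ip (G x) (N x) (nabla G X X x).
Proof.
move=> Wx sX hX; have [V [sV vV uV]] := frame_unit_ver hf hB hM r0 e.
have curv E F K y : smooth_on W E -> smooth_on W F -> smooth_on W K ->
  W y -> curvature G E F K y =
    c *: (ip (G y) (F y) (K y) *: E y - ip (G y) (E y) (K y) *: F y).
  move=> sE sF sK Wy; apply: (hcurv (fr_chart_atlas e) (sub_open L)) => // z Wz.
  by have [] := fr_sub Wz.
have := mixed_curvature L umb sV vV uV curv Wx sX hX.
set a := _ *m hproj _ _.
have : 0 <= ip (G x) a a by apply: frame_horizontal_ge0 => //; exact: hor_hproj.
move: (ip _ a a) ('D_(X x) _ x) (ip _ (N x) (nabla _ _ _ _)) => a2 d i.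
by lra.
Qed.

Lemma frame_point y : W y -> frame_around (point_at (fr_chart e) y) e.
Proof.
move=> Wy; have [ty _] := fr_sub Wy.
by split; [exact: point_at_source|rewrite point_atK].
Qed.

Lemma sqnorm_H_point y : W y ->
  sqnorm_H e (point_at (fr_chart e) y) = ip (G y) (N y) (N y).
Proof. by move=> Wy; have [ty _] := fr_sub Wy; rewrite sqnorm_HE point_atK. Qed.

Lemma sqnorm_H_ge0 p : frame_around p e -> 0 <= sqnorm_H e p.
Proof.
by move=> [cp Wp]; rewrite sqnorm_HE; apply: frame_horizontal_ge0; last exact: umb_hor umb _ Wp.
Qed.

Lemma smooth_on_sqnorm : smooth_on W (fun y => ip (G y) (N y) (N y)).
Proof.
exact: (smooth_on_ip (sub_open L) (sub_metric_smooth L) (umb_smooth umb) (umb_smooth umb)).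
Qed.

(** At a maximum of h, the previous inequality for X = N has right side 0. *)
Lemma sqnorm_H_max p : frame_around p e ->
  (forall q, frame_around q e -> sqnorm_H e q <= sqnorm_H e p) ->
  sqnorm_H e p * (sqnorm_H e p + c) <= 0.
Proof.
move=> [cp Wp] max; pose x := Defs.coord (fr_chart e) p.
have Wx : W x by exact: Wp.
have D0 : 'D_(N x) (fun y => ip (G y) (N y) (N y)) x = 0.
  apply: (local_max_derive0 _ (sub_open L) (fun y Wy => smooth_on_diff smooth_on_sqnorm Wy) Wx).
  apply: (near_open (sub_open L) Wx) => y Wy.
  by have := max _ (frame_point Wy); rewrite sqnorm_H_point.
have i0 : ip (G x) (N x) (nabla G N N x) = 0.
  have := nabla_compat (sub_open L) (sub_metric_smooth L) (sub_sym L) (sub_unit L) N Wx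
    (umb_smooth umb) (umb_smooth umb).
  rewrite D0 [X in _ = X + _](ipC L) //.
  by move/eqP; rewrite -mulr2n eq_sym mulrn_eq0 => /eqP.
have := frame_mixed_curvature Wx (umb_smooth umb) (umb_hor umb).
rewrite D0 i0 subrr sqnorm_HE -/x -/G -/N.
by rewrite mulrDr [X in _ <= _ -> _ + X <= _]mulrC expr2.
Qed.

(** The inequality for a unit horizontal X from the frame, with N = 0. *)
Lemma minimal_fibres_curvature p : (n <= m)%N -> (0 < n)%N -> frame_around p e ->
  (forall q, frame_around q e -> sqnorm_H e q = 0) -> c <= 0.
Proof.
move=> nm n0 [cp Wp] H0; pose x := Defs.coord (fr_chart e) p.
have Wx : W x by exact: Wp.
have N0 y : W y -> N y = 0.
  move=> Wy; apply/eqP/negPn/negP => Ny0.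
  have := horizontal_positive hf hB (fr_chart_atlas e) (fr_base_atlas e) (fr_sub Wy)
    (umb_hor umb Wy) Ny0.
  by rewrite -/G -sqnorm_H_point // H0 ?ltxx //; exact: frame_point.
have rm : (r < m)%N by rewrite ltn_subrL n0 (leq_trans n0 nm).
have [eps1 se oe _ he] := fr_adapted e.
pose X := fr_field e (Ordinal rm).
have hX y : W y -> hor (G y) ('J phi y) (X y) by move=> Wy; exact: he.
have X1 : ip (G x) (X x) (X x) = 1.
  have [] := eps1 (Ordinal rm) => E; have := frame_horizontal_ge0 Wx (hX _ Wx);
    rewrite oe // eqxx E //.
  by rewrite oppr_ge0 ler10.
have := frame_mixed_curvature Wx (se (Ordinal rm)) hX.
rewrite -/X X1 N0 // !ip0l expr0n add0r mulr1 subr0.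
rewrite (@near_eq_derive _ _ _ _ (fun=> 0)) ?derive_cst //.
by apply: (near_open (sub_open L) Wx) => y Wy; rewrite N0 // ip0l.
Qed.

End OneFrame.

(** Frames are chosen around all points to make h a function on M, continuous
    because it is computed near each point by the frame chosen there. *)
Lemma rigidity : compact [set: M] -> (n <= m)%N -> (0 < n)%N ->
  (forall (p : M) (e : local_frame g f r), frame_around p e -> 0 <= sqnorm_H e p + c) ->
  forall (p : M) (e : local_frame g f r), frame_around p e -> sqnorm_H e p + c = 0.
Proof.
move=> cM nm n0 hH p e pe.
have /choice[E EP] : forall q : M, exists e : local_frame g f r, frame_around q e.
  by move=> q; exact: (frame_exists hf hB hM).
pose h q := sqnorm_H (E q) q.
have hE q (e' : local_frame g f r) : frame_around q e' -> sqnorm_H e' q = h q.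
  by move=> qe'; exact: (sqnorm_H_frame_independent hf hB hM humb r0 qe' (EP q)).
have ch : continuous h.
  move=> q; have [cq Wq] := EP q; set e0 := E q in cq Wq.
  have nq : \forall z \near q, frame_around z e0.
    have n1 : \forall z \near q, source (fr_chart e0) z.
      by apply: open_nbhs_nbhs; split=> //; exact: source_open.
    have n2 : \forall z \near q, fr_dom e0 (Defs.coord (fr_chart e0) z).
      apply: (near_comp (P := fr_dom e0) (Defs.coord_continuous cq)).
      by apply: open_nbhs_nbhs; split=> //; exact: fr_open.
    by apply: filterS2 n1 n2 => z.
  pose F y := ip (gram g (fr_chart e0) y) (frame_N e0 y) (frame_N e0 y).
  have sF : smooth_on (fr_dom e0) F by exact: smooth_on_sqnorm.
  have cF : {for q, continuous (F \o Defs.coord (fr_chart e0))}.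
    apply: continuous_comp; first exact: Defs.coord_continuous.
    exact: (differentiable_continuous (smooth_on_diff sF Wq)).
  rewrite /continuous_at -(hE q e0 (EP q)) sqnorm_HE.
  apply: cvg_trans cF; apply: near_eq_cvg.
  by apply: filterS nq => z ze; rewrite /= -(hE z e0 ze) sqnorm_HE.
have [|q _ maxq] := @compact_EVT_max M R h setT (ex_intro _ p I) cM.
  exact: continuous_subspaceT.
have {}maxq z : h z <= h q by apply: maxq; exact/mem_set.
have h_ge0 z : 0 <= h z := sqnorm_H_ge0 (EP z).
have hc z : 0 <= h z + c := hH z (E z) (EP z).
have hq_max : h q * (h q + c) <= 0.
  by apply: (sqnorm_H_max (EP q)) => z ze; rewrite (hE z _ ze); exact: maxq.
rewrite (hE p e pe).
have minimal : (forall z, h z = 0) -> c <= 0.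
  by move=> h0; apply: (minimal_fibres_curvature nm n0 pe) => z ze; rewrite (hE z _ ze).
clear hE ch; clearbody h.
have : h q * (h q + c) == 0 by rewrite eq_le hq_max mulr_ge0.
rewrite mulf_eq0 => /orP[/eqP hq|/eqP hqc0]; last first.
  by apply/eqP; rewrite eq_le hc andbT -hqc0 lerD2r.
have h0 z : h z = 0 by apply/eqP; rewrite eq_le h_ge0 andbT -hq.
by have := hc p; rewrite h0 add0r => c0; apply/eqP; rewrite eq_le c0 minimal.
Qed.

End Rigidity.

Theorem proposition3p22 (R : realType) (m n r : nat) (c : R)
    (M : manifold R m) (g : metric M) (B : manifold R n) (g' : metric B)
    (f : M -> B)
    (hr : r = (m - n)%N) (hr2 : (2 <= r)%N) (hn3 : (3 <= n)%N)
    (hBriem : riemannian g') (hBcompact : compact [set: B])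
    (hBorient : orientable B)
    (hMindex : metric_index g r) (hMcurv : constant_curvature g c)
    (hf : semi_riemannian_submersion g g' f)
    (hfibconn : forall b : B, connected (fibre f b))
    (hfibcompact : forall b : B, compact (fibre f b))
    (humb : totally_umbilic_fibres g f r)
    (hH : forall (p : M) (e : local_frame g f r), frame_around p e ->
      0 <= sqnorm_H e p + c)
    (hHA : forall (p : M) (e : local_frame g f r), frame_around p e ->
      0 <= 3 * sqnorm_H e p + n%:R * c - r%:R^-1 * sqnorm_A e p) :
  forall (p : M) (e : local_frame g f r), frame_around p e ->
    sqnorm_H e p + c = 0.
Proof.
subst r; apply: (rigidity hf) => //.
- exact: leq_trans hr2.
- exact: (total_space_compact hf).
- by rewrite ltnW // -subn_gt0; exact: leq_trans hr2.
- exact: leq_trans hn3.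
Qed.
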